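(* Let $C=\bigcup_i C_i$ be an $n$-dimensional cube together with a (finite) cubical decomposition, let $\tilde C$ be the corresponding polytope, and let $\phi:\tilde C\to\mathscr{Z}^n$ be a non-degenerate labeling of $\tilde C$. If $\mathrm{ind}_{\tilde C}(\phi)\neq 0$, then there exists at least one cube $C_i$ such that $\mathrm{ind}_{C_i}(\phi)\neq0$, and hence $C_i$ is completely labeled relative to $\phi$.
   Context: Cubical decomposition: $C$ is the union of finitely many $n$-dimensional cubes $C_i$ with pairwise disjoint interiors, such that $C_i\cap C_j$ is empty or a common face for $i\ne j$. The polytope $\tilde C$ is $C$ regarded as a polytope by appending to the vertices of $C$ all vertices of the $C_i$ lying on faces of $C$, and to the faces of $C$ all faces of the $C_i$ lying on faces of $C$; so the $(n-1)$-dimensional faces of $\tilde C$ are the $(n-1)$-dimensional faces of the $C_i$ contained in $\partial C$. All polytopes are oriented, the $C_i$ and $\tilde C$ consistently. Vector labels: $\mathscr{Z}=\{\pm1\}$; for $\ell\in\mathscr{Z}^n$, $\mathscr{O}_\ell=\{x\in\mathbb{R}^n : \ell_i x_i\ge 0\ \forall i\}$. A collection of labels (repetitions allowed) $\{\ell_1,\ldots,\ell_{n+1}\}\subset\mathscr{Z}^n$ is complete if $\mathscr{O}_{\ell_1}\cap\dots\cap\mathscr{O}_{\ell_{n+1}}=\{\mathbf 0\}$; equivalently, for each coordinate $i$ some two of these labels have opposite $i$-th coordinates. A cube is completely labeled if the labels of its vertices include a complete collection. A labeling of a polytope is non-degenerate if no proper face of the polytope contains points whose labels include a complete collection. Change of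 labels: a special convex polyhedral cone partition of $\mathbb{R}^n$ is a collection of $n+1$ convex cones $\mathscr{N}_1,\ldots,\mathscr{N}_{n+1}$, each an intersection of finitely many half-spaces of the form $\{x_k\ge0\}$ or $\{x_k\le 0\}$, such that $\bigcup_j\mathscr{N}_j=\mathbb{R}^n$, the interiors are pairwise disjoint, and $\bigcap_j\mathscr{N}_j=\{\mathbf 0\}$. The corresponding change of labels is $\psi:\mathscr{Z}^n\to\{1,\ldots,n+1\}$, $\psi(\ell)=j$ where $\mathscr{O}_\ell\subseteq\mathscr{N}_j$. Index: for an oriented polytope $P$ with vertex set $V(P)$ and a labeling $\phi$ by positive integers, $\mathrm{ind}_P(\phi)$ is defined recursively. If $\dim P=0$ and $\phi(V(P))=\{1\}$ it is $1$. If $\dim P=1$ and $\phi(V(P))=\{1,2\}$ it is $\pm1$ according to whether the labels go from $1$ to $2$ or from $2$ to $1$ along the orientation. If $\dim P=k$ and $\phi(V(P))\ne\{1,\ldots,k+1\}$ it is $0$. If $\dim P=k\ge2$ and $\phi(V(P))=\{1,\ldots,k+1\}$ it is $\sum_S\mathrm{ind}_S(\phi)$ over all $(k-1)$-dimensional faces $S$ with induced orientation. For an $n$-dimensional polytope (or cube) $P$ and a labeling $\phi:P\to\mathscr{Z}^n$, $\mathrm{ind}_P(\phi)$ is defined, up to sign, as $\mathrm{ind}_P(\psi\circ\phi)$ for a fixed change of labels $\psi$ (for non-degenerate labelings it does not depend on $\psi$ up to sign). *)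

(* Defs.v *)
From HB Require Import structures.
From mathcomp Require Import all_boot all_order all_algebra.
From mathcomp Require Import all_classical all_reals.
From mathcomp Require Import topology normedtype convex.

Set Implicit Arguments.
Unset Strict Implicit.
Unset Printing Implicit Defensive.

Import Order.TTheory GRing.Theory Num.Theory.
Import numFieldNormedType.Exports.

Local Open Scope classical_set_scope.
Local Open Scope ring_scope.

Section Polytopes.
Variables (R : realType) (n : nat).
Implicit Types (P F S : set 'rV[R]_n) (V : set 'rV[R]_n).

(* Nonempty faces of a convex set, the set itself included; for a convex
   polytope these are its faces in the usual sense. *)
Definition is_face P F : Prop :=
  [/\ F !=set0, F `<=` P, convex_set (F : set (convex_lmodType 'rV[R]_n)) &
    forall (x y : 'rV[R]_n) (t : R), P x -> P y -> 0 < t < 1 ->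
      F (t *: x + (1 - t) *: y) -> F x /\ F y].

(* The rows of B form a basis of the direction space of the affine hull of P;
   hence dim P = k.  Frames also serve to orient P: two frames of P give the
   same orientation iff their change-of-basis matrix has positive determinant. *)
Definition is_frame (k : nat) P (B : 'M[R]_(k, n)) : Prop :=
  [/\ P !=set0, row_free B,
    (forall x y, P x -> P y -> (y - x <= B)%MS) &
    forall U : 'M[R]_n,
      (forall x y, P x -> P y -> (y - x <= U)%MS) -> (B <= U)%MS].

Definition has_dim P (k : nat) : Prop := exists B : 'M[R]_(k, n), is_frame P B.

(* The orientation B' of S is induced, by the rule "outward vector first", by
   the orientation B of P.  Since S lies on the boundary of P, a vector s - p
   from a point p of P to a point s of S never points inwards. *)
Definition induces (k : nat) P (B : 'M[R]_(k.+1, n)) S (B' : 'M[R]_(k, n)) :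
    Prop :=
  is_frame S B' /\
  exists (s p : 'rV[R]_n) (M : 'M[R]_k.+1),
    [/\ S s, P p, 0 < \det M & col_mx (s - p) B' = M *m B].

Definition induced_frame (k : nat) P (B : 'M[R]_(k.+1, n)) S : 'M[R]_(k, n) :=
  xget 0 (induces P B S).

(* A convex polytope together with the collection of its faces (itself
   included); the boundary is allowed to be subdivided, so that the faces need
   not be those of the convex set [body]. *)
Record polytope := Polytope {
  body : set 'rV[R]_n;
  faces : set (set 'rV[R]_n) }.

Definition std_polytope P : polytope := Polytope P (is_face P).

Definition face_polytope (P : polytope) S : polytope :=
  Polytope S [set F | faces P F /\ F `<=` S].

Definition vertices (P : polytope) : set 'rV[R]_n := [set x | faces P [set x]].

Definition faces_of_dim (P : polytope) (k : nat) : set (set 'rV[R]_n) :=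
  [set S | faces P S /\ has_dim S k].

(* Index of the labeling f of the k-dimensional polytope P oriented by B. *)
Fixpoint ind (f : 'rV[R]_n -> nat) (k : nat) (P : polytope) :
    'M[R]_(k, n) -> int :=
  match k return 'M[R]_(k, n) -> int with
  | 0 => fun _ => if `[< f @` vertices P = [set 1%N] >] then 1 else 0
  | k'.+1 => fun B =>
      if ~~ `[< f @` vertices P = [set j | (1 <= j <= k'.+2)%N] >] then 0
      else if k' == 0%N then
        if `[< exists (x y : 'rV[R]_n) (c : R),
                 [/\ vertices P x /\ f x = 1%N, vertices P y /\ f y = 2%N,
                     0 < c & y - x = c *: row ord0 B] >] then 1 else -1
      else \sum_(S \in faces_of_dim P k')
             ind f (face_polytope P S) (induced_frame (body P) B S)
  end.

(* k-dimensional cubes: nondegenerate affine images of [0, 1]^k. In particular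
   Euclidean cubes of any position and size are covered, and so are boxes. *)
Definition is_cube (k : nat) (C : set 'rV[R]_n) : Prop :=
  exists (a : 'rV[R]_n) (v : 'M[R]_(k, n)), row_free v /\
    C = [set x | exists t : 'rV[R]_k,
                   (forall i, 0 <= t 0 i <= 1) /\ x = a + t *m v].

Definition is_cubical_decomposition (I : finType) (C : set 'rV[R]_n)
    (c : I -> set 'rV[R]_n) : Prop :=
  [/\ forall i, is_cube n (c i),
      C = \bigcup_(i in [set: I]) c i,
      forall i j, i != j -> (c i)° `&` (c j)° = set0 &
      forall i j, i != j -> c i `&` c j = set0 \/
        (is_face (c i) (c i `&` c j) /\ is_face (c j) (c i `&` c j))].

(* C with the boundary structure of the decomposition: the proper faces are the
   faces of the cubes c i lying on some proper face of C.  They supersede the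
   original proper faces of C, each of which they subdivide; the vertices of C
   remain vertices. *)
Definition subdivided_polytope (I : finType) (C : set 'rV[R]_n)
    (c : I -> set 'rV[R]_n) : polytope :=
  Polytope C [set F | F = C \/
    (exists i, is_face (c i) F) /\
    (exists G, [/\ is_face C G, G <> C & F `<=` G])].

End Polytopes.

Section VectorLabels.
Variables (R : realType) (n : nat).

(* {-1, 1}^n, with false and true standing for 1 and -1 respectively. *)
Definition vlabel := {ffun 'I_n -> bool}.

(* The half-space {x_k >= 0} (for b = false) or {x_k <= 0} (for b = true). *)
Definition half_space (k : 'I_n) (b : bool) : set 'rV[R]_n :=
  [set x | 0 <= (-1) ^+ b * x 0 k].

Definition orthant (l : vlabel) : set 'rV[R]_n :=
  [set x | forall i, half_space i (l i) x].

Definition complete_collection (L : 'I_n.+1 -> vlabel) : Prop :=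
  \bigcap_(j in [set: 'I_n.+1]) orthant (L j) = [set 0].

Definition includes_complete (A : set vlabel) : Prop :=
  exists L : 'I_n.+1 -> vlabel, (forall j, A (L j)) /\ complete_collection L.

Definition completely_labeled (phi : 'rV[R]_n -> vlabel) (P : polytope R n) :
    Prop :=
  includes_complete (phi @` vertices P).

Definition nondegenerate_labeling (phi : 'rV[R]_n -> vlabel) (P : polytope R n) : Prop :=
  forall F, faces P F -> F <> body P -> ~ includes_complete (phi @` F).

Definition is_special_cone (N : set 'rV[R]_n) : Prop :=
  exists H : {set 'I_n * bool},
    N = [set x | forall h, h \in H -> half_space h.1 h.2 x].

Definition is_special_partition (N : 'I_n.+1 -> set 'rV[R]_n) : Prop :=
  [/\ forall j, is_special_cone (N j),
      \bigcup_(j in [set: 'I_n.+1]) N j = setT,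
      forall i j, i != j -> (N i)° `&` (N j)° = set0 &
      \bigcap_(j in [set: 'I_n.+1]) N j = [set 0]].

Definition is_change_of_labels (N : 'I_n.+1 -> set 'rV[R]_n)
    (psi : vlabel -> 'I_n.+1) : Prop :=
  is_special_partition N /\ forall l, orthant l `<=` N (psi l).

(* Index of a vector labeling with respect to a change of labels; the values
   0, ..., n of psi are shifted to the integer labels 1, ..., n + 1. *)
Definition vind (psi : vlabel -> 'I_n.+1) (phi : 'rV[R]_n -> vlabel)
    (P : polytope R n) (B : 'M[R]_n) : int :=
  ind (fun x => (psi (phi x)).+1) P B.

End VectorLabels.

(* Main.v *)
Require Import Defs.
From mathcomp Require Import all_boot all_order all_algebra.
From mathcomp Require Import all_classical all_reals.
From mathcomp Require Import topology normedtype convex.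
From mathcomp Require Import interval_inference zify ring lra.

(** Why the theorem holds. The index is additive: the signed index of the big
cube, with its subdivided boundary, is the sum of the indices of the small
cubes. If the former is nonzero, so is one of the latter, and a nonzero index
forces the labels 1, ..., n + 1 to occur at the vertices of that cube. Choosing
one vertex per label gives n + 1 orthants lying in the n + 1 different cones,
whose intersection is the origin, so the cube is completely labeled
([completely_labeled_of_ind]).

For additivity one would like to write the index of each small cube as the sum
of the indices of its oriented facets. The definition only allows this when the
cube carries all the labels. The sum over the facets nevertheless vanishes when
some label is missing ([oind_facet_sum]): if the label n + 1 is missing, one
expands each facet once more and uses that the boundary of a boundary is zero
([facet_sum_boundary]); if another label is missing, every facet misses it too.
So the sum over all small cubes is a sum over all pairs (cube, facet), called
walls below.

A wall which is not on the boundary of the big cube is shared by exactly two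
cubes, lying on opposite sides, so that its two contributions cancel
([inner_partner], [at_most_two], [term_opp], [sum_inner]). A wall on the
boundary belongs to a single cube, and its induced orientation is the same for
that cube as for the big one ([outer_unique], [term_outer]). What remains is
therefore the recursive expression of the index of the big cube
([ind_subdivided]).

Orientations are compared through one determinant, [side beta (s - y)]: for a
frame [beta] of a wall containing [s], its sign tells on which side of the wall
the point [y] lies. In dimension 1 the index is not defined by the recursion;
it is put in the same form by letting the index of an oriented point carry an
extra sign -1 ([oind]). *)

Set Implicit Arguments.
Unset Strict Implicit.
Unset Printing Implicit Defensive.
Import Order.TTheory GRing.Theory Num.Theory.
Import numFieldNormedType.Exports.
Local Open Scope classical_set_scope.
Local Open Scope ring_scope.

(** * Faces and frames of convex sets *)

Section Faces.
Variables (R : realType) (n : nat).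
Implicit Types (P F S : set 'rV[R]_n) (x y : 'rV[R]_n).

Lemma convex_setE P :
  convex_set (P : set (convex_lmodType 'rV[R]_n)) <->
  forall x y t, P x -> P y -> 0 < t < 1 -> P (t *: x + (1 - t) *: y).
Proof.
split=> [cP x y t Px Py /andP[t0 t1]|cP].
  have := cP x y (Itv01 (ltW t0) (ltW t1)) (mem_set Px) (mem_set Py).
  by move/set_mem.
apply/convex_setW => x y /set_mem Px /set_mem Py k k0 k1; apply/mem_set.
by apply: (cP x y k%:num) => //; rewrite k0.
Qed.

Lemma is_faceP P F : is_face P F <->
  [/\ F !=set0, F `<=` P,
   forall x y t, F x -> F y -> 0 < t < 1 -> F (t *: x + (1 - t) *: y) &
   forall x y t, P x -> P y -> 0 < t < 1 ->
     F (t *: x + (1 - t) *: y) -> F x /\ F y].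
Proof. by split=> -[? ? /convex_setE ? ?]; split. Qed.

Lemma face_of_face P F S : is_face P F -> S `<=` F ->
  is_face F S <-> is_face P S.
Proof.
move=> /is_faceP[_ FP cF eF] SF; split=> /is_faceP[S0 SF' cS eS]; apply/is_faceP.
  split=> // [|x y t Px Py t01 Sxy]; first exact: subset_trans FP.
  by have [Fx Fy] := eF _ _ _ Px Py t01 (SF _ Sxy); apply: eS Sxy.
by split=> // x y t Fx Fy; apply: eS; apply: FP.
Qed.

(** Faces of a face are faces, so in the recursive definition of the index the
faces met below a cube are again cubes with their own faces, and the recursion
stays within standard polytopes. *)
Lemma face_polytope_std P F :
  is_face P F -> face_polytope (std_polytope P) F = std_polytope F.
Proof.
move=> PF; congr Polytope; apply/seteqP; split=> S /=.
  by case=> PS SF; apply/(face_of_face PF SF).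
move=> FS; have SF : S `<=` F by case: FS.
by split=> //; apply/(face_of_face PF SF).
Qed.

(** Each [y] of [S] and its mirror image have [x] as midpoint, so extremality of
[F] at [x] forces both into [F]. It is used with the center of a cube [S], which
thus plays the part of a relative interior point. *)
Lemma face_symmetric_center P F S x : is_face P F -> S `<=` P -> F x ->
  (forall y, S y -> S (2 *: x - y)) -> S `<=` F.
Proof.
move=> /is_faceP[_ _ _ eF] SP Fx symS y Sy.
have h01 : 0 < (2^-1 : R) < 1 by lra.
suff [] : F y /\ F (2 *: x - y) by [].
apply: (eF _ _ _ _ _ h01); [exact: SP | exact/SP/symS |].
suff -> : 2^-1 *: y + (1 - 2^-1) *: (2 *: x - y) = x by [].
apply/rowP => i; rewrite !mxE; lra.
Qed.

Lemma frame_eqmx P k k' (B : 'M[R]_(k, n)) (B' : 'M[R]_(k', n)) :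
  is_frame P B -> is_frame P B' -> (B :=: B')%MS.
Proof.
move=> [_ _ PB minB] [_ _ PB' minB']; apply/eqmxP/andP; split.
  by rewrite -(genmxE B'); apply: minB => x y *; rewrite genmxE; apply: PB'.
by rewrite -(genmxE B); apply: minB' => x y *; rewrite genmxE; apply: PB.
Qed.

Lemma frame_dim P k k' (B : 'M[R]_(k, n)) (B' : 'M[R]_(k', n)) :
  is_frame P B -> is_frame P B' -> k = k'.
Proof.
move=> PB PB'; have e := frame_eqmx PB PB'.
case: PB PB' => _ /eqP rB _ _ [_ /eqP rB' _ _].
by rewrite -[LHS]rB -[RHS]rB' e.
Qed.

Lemma frame_trans P S k (B : 'M[R]_(k, n)) (B' : 'M[R]_(k, n)) :
  is_frame P B -> is_frame S B' -> S `<=` P -> (B' :=: B)%MS.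
Proof.
move=> [_ /eqP rB PB minB] [_ /eqP rB' _ minB'] SP.
have s : (B' <= B)%MS.
  by rewrite -(genmxE B); apply: minB' => x y *; rewrite genmxE; apply: PB; apply: SP.
apply/eqmxP; rewrite s /=; have [_ <-] := mxrank_leqif_sup s.
by rewrite rB rB'.
Qed.

(** Two frames of the same set differ by an invertible matrix; the sign of its
determinant compares the two orientations. *)
Lemma row_free_change k (B B' : 'M[R]_(k, n)) :
  row_free B -> (B' :=: B)%MS -> exists2 A, A \in unitmx & B = A *m B'.
Proof.
move=> rB e; exists (B *m pinvmx B'); last by rewrite mulmxKpV ?e.
rewrite -row_free_unit -kermx_eq0 -submx0; apply/row_subP => i.
set w := row i _; have : w *m (B *m pinvmx B') = 0.
  by rewrite /w -row_mul mulmx_ker row0.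
move/(congr1 (mulmx^~ B')); rewrite -mulmxA mulmxKpV ?e // mul0mx => wB.
by rewrite submx0 -(mulmxKp rB w) wB mul0mx.
Qed.

Lemma frame_change P k (B B' : 'M[R]_(k, n)) :
  is_frame P B -> is_frame P B' -> exists2 A, A \in unitmx & B = A *m B'.
Proof.
move=> PB PB'; have [_ rB _ _] := PB.
exact: row_free_change rB (frame_eqmx PB' PB).
Qed.

Lemma row_free_unitM k (A : 'M[R]_k) (B : 'M[R]_(k, n)) :
  A \in unitmx -> row_free B -> row_free (A *m B).
Proof.
by move=> uA rB; rewrite -row_leq_rank mxrankMfree // mxrank_unit.
Qed.

Lemma is_frameM P k (A : 'M[R]_k) (B : 'M[R]_(k, n)) :
  A \in unitmx -> is_frame P B -> is_frame P (A *m B).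
Proof.
move=> uA [P0 rB PB mB].
have e : (A *m B :=: B)%MS by apply: eqmxMfull; rewrite row_full_unit.
split=> //; first exact: row_free_unitM.
  by move=> x y Px Py; rewrite e; apply: PB.
by move=> U hU; rewrite e; apply: mB.
Qed.

End Faces.

(** The closed conditions defining a cube are finitely many affine inequalities;
those that are strict at a point survive a small step in any given direction. It
serves wherever a point has to be moved slightly. *)
Lemma small_perturbation (R : realType) (T : finType) (x d : T -> R) :
  (forall i, 0 < x i) ->
  exists2 e0, 0 < e0 & forall e, 0 < e <= e0 -> forall i, 0 < x i + e * d i.
Proof.
move=> x0; pose f i := x i / (1 + `|d i|).
have dp i : 0 < 1 + `|d i| by rewrite ltr_pwDl.
exists (\big[Num.min/1]_i f i).
  by apply: lt_bigmin => // i _; rewrite divr_gt0.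
move=> e /andP[e0 ele] i.
have : e * (1 + `|d i|) <= x i.
  by rewrite -ler_pdivlMr //; apply: le_trans ele _; apply: bigmin_le.
have : - (e * `|d i|) <= e * d i.
  by rewrite -mulrN ler_pM2l // lerNl -normrN ler_norm.
lra.
Qed.

(** * Cubes and their facets *)

Section Cubes.
Variables (R : realType) (n : nat).

Definition cube k (a : 'rV[R]_n) (v : 'M[R]_(k, n)) : set 'rV[R]_n :=
  [set x | exists t : 'rV[R]_k, (forall i, 0 <= t 0 i <= 1) /\ x = a + t *m v].

Definition facet k (a : 'rV[R]_n) (v : 'M[R]_(k.+1, n)) (p : 'I_k.+1) (b : bool)
  : set 'rV[R]_n := cube (a + b%:R *: row p v) (row' p v).

(** The pseudo-inverse lets one formula serve cubes of every dimension [k <= n];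
the result is meaningful on the affine hull of the cube only. *)
Definition coords k (a : 'rV[R]_n) (v : 'M[R]_(k, n)) (x : 'rV[R]_n) : 'rV[R]_k :=
  (x - a) *m pinvmx v.

Definition center k (a : 'rV[R]_n) (v : 'M[R]_(k, n)) : 'rV[R]_n :=
  a + const_mx 2^-1 *m v.

Variables (k : nat) (a : 'rV[R]_n).

Lemma coordsK (v : 'M[R]_(k, n)) t : row_free v -> coords a v (a + t *m v) = t.
Proof. by move=> rv; rewrite /coords addrC addKr mulmxKp. Qed.

Lemma cubeE (v : 'M[R]_(k, n)) x : row_free v -> cube a v x <->
  (forall i, 0 <= coords a v x 0 i <= 1) /\ x = a + coords a v x *m v.
Proof.
move=> rv; split=> [[t [t01 ->]]|[t01 e]]; first by rewrite coordsK.
by exists (coords a v x).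
Qed.

Lemma coords_conv (v : 'M[R]_(k, n)) x y t i :
  coords a v (t *: x + (1 - t) *: y) 0 i =
  t * coords a v x 0 i + (1 - t) * coords a v y 0 i.
Proof.
rewrite /coords.
have -> : t *: x + (1 - t) *: y - a = t *: (x - a) + (1 - t) *: (y - a).
  by apply/rowP => j; rewrite !mxE; ring.
by rewrite mulmxDl -!scalemxAl !mxE.
Qed.

Lemma cube_conv (v : 'M[R]_(k, n)) x y t : row_free v -> cube a v x ->
  cube a v y -> 0 < t < 1 -> cube a v (t *: x + (1 - t) *: y).
Proof.
move=> rv [u [hu ->]] [w [hw ->]] t01; exists (t *: u + (1 - t) *: w); split.
  by move=> i; rewrite !mxE; move: (hu i) (hw i); nra.
rewrite mulmxDl -!scalemxAl; move: (u *m v) (w *m v) => U W.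
by apply/rowP => i; rewrite !mxE; ring.
Qed.

Lemma cube_center (v : 'M[R]_(k, n)) : cube a v (center a v).
Proof. by exists (const_mx 2^-1); split=> // i; rewrite mxE; lra. Qed.

Lemma coords_center (v : 'M[R]_(k, n)) i : row_free v ->
  coords a v (center a v) 0 i = 2^-1.
Proof. by move=> rv; rewrite coordsK // mxE. Qed.

Lemma cube_reflect (v : 'M[R]_(k, n)) y :
  cube a v y -> cube a v (2 *: center a v - y).
Proof.
move=> [t [ht ->]]; exists (const_mx 1 - t); split.
  by move=> i; rewrite !mxE; have := ht i; lra.
rewrite /center mulmxBl.
have -> : (const_mx 1 : 'rV[R]_k) = 2 *: const_mx 2^-1.
  by apply/rowP => i; rewrite !mxE; lra.
rewrite -scalemxAl; move: (const_mx _ *m v) (t *m v) => U W.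
by apply/rowP => i; rewrite !mxE; ring.
Qed.

Lemma cube_frame (v : 'M[R]_(k, n)) : row_free v -> is_frame (cube a v) v.
Proof.
move=> rv; split=> //; first by exists (center a v); apply: cube_center.
  move=> _ _ [t [_ ->]] [u [_ ->]].
  by rewrite opprD addrACA subrr add0r -mulmxBl submxMl.
move=> U hU; apply/row_subP => i.
have -> : row i v = (a + delta_mx 0 i *m v) - (a + 0 *m v).
  by rewrite mul0mx addr0 addrC addKr rowE.
apply: hU; first by exists 0; split=> // j; rewrite mxE lexx ler01.
by exists (delta_mx 0 i); split=> // j; rewrite mxE eqxx; case: (j == i); rewrite /= ?lexx ?ler01.
Qed.

End Cubes.

Section Facets.
Variables (R : realType) (n k : nat) (a : 'rV[R]_n) (v : 'M[R]_(k.+1, n)).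
Hypothesis rv : row_free v.

Lemma mulmx_row_row' (t : 'rV[R]_k.+1) p :
  t *m v = t 0 p *: row p v + col' p t *m row' p v.
Proof.
rewrite !mulmx_sum_row (bigD1_ord p) //=; congr (_ + _).
apply: eq_bigr => i _; rewrite mxE; congr (_ *: _).
by apply/rowP => j; rewrite !mxE.
Qed.

Lemma row_free_row' p : row_free (row' p v).
Proof.
rewrite -kermx_eq0 -submx0; apply/row_subP => i.
have : row i (kermx (row' p v)) *m row' p v = 0.
  by rewrite -row_mul mulmx_ker row0.
move: (row i _) => w wv; pose t : 'rV[R]_k.+1 := \row_j oapp (w 0) 0 (unlift p j).
have tw : col' p t = w by apply/rowP => j; rewrite !mxE liftK.
have : t *m v = 0.
  by rewrite (mulmx_row_row' t p) tw wv mxE unlift_none scale0r addr0.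
move=> tv; rewrite submx0 -tw -(mulmxKp rv t) tv mul0mx.
by apply/eqP/rowP => j; rewrite !mxE.
Qed.

Lemma facetE p b x :
  facet a v p b x <-> cube a v x /\ coords a v x 0 p = b%:R.
Proof.
split=> [[t [t01 ->]]|[[t [t01 ->]]]].
  pose u : 'rV[R]_k.+1 := \row_j oapp (t 0) b%:R (unlift p j).
  have ut : col' p u = t by apply/rowP => j; rewrite !mxE liftK.
  have up : u 0 p = b%:R by rewrite mxE unlift_none.
  have -> : a + b%:R *: row p v + t *m row' p v = a + u *m v.
    by rewrite (mulmx_row_row' u p) ut up addrA.
  split; last by rewrite coordsK.
  exists u; split=> // i; rewrite mxE; case: unliftP => //= _.
  by case: b {u ut up}; rewrite ?lexx ler01.
rewrite coordsK // => tp; exists (col' p t); split.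
  by move=> i; rewrite mxE.
by rewrite (mulmx_row_row' t p) tp addrA.
Qed.

Lemma facet_sub p b : facet a v p b `<=` cube a v.
Proof. by move=> x /facetE[]. Qed.

Lemma facet_face p b : is_face (cube a v) (facet a v p b).
Proof.
apply/is_faceP; split.
- by eexists; apply: cube_center.
- exact: facet_sub.
- move=> x y t; apply: cube_conv; exact: row_free_row'.
move=> x y t Px Py t01 /facetE[_]; rewrite coords_conv => e.
have [/(_ p) x01 _] := (cubeE _ _ rv).1 Px.
have [/(_ p) y01 _] := (cubeE _ _ rv).1 Py.
split; apply/facetE; split=> //; move: e; case: b => /= e; nra.
Qed.

Definition facet_center p (b : bool) : 'rV[R]_n :=
  center (a + b%:R *: row p v) (row' p v).

Lemma coords_facet_center p b q :
  coords a v (facet_center p b) 0 q = if q == p then b%:R else 2^-1.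
Proof.
pose u : 'rV[R]_k.+1 := \row_j if j == p then b%:R else 2^-1.
rewrite /facet_center /center.
have -> : a + b%:R *: row p v + const_mx 2^-1 *m row' p v = a + u *m v.
  rewrite (mulmx_row_row' u p) mxE eqxx addrA; congr (_ + _ *m _).
  by apply/rowP => j; rewrite !mxE eq_sym (negbTE (neq_lift _ _)).
by rewrite coordsK // mxE.
Qed.

Lemma facet_center_in p b : facet a v p b (facet_center p b).
Proof. exact: cube_center. Qed.

Lemma facet_center_inj p b q c : facet a v q c (facet_center p b) ->
  p = q /\ b = c.
Proof.
move=> /facetE[_]; rewrite coords_facet_center; case: eqP => [->|_].
  by case: b; case: c => //= e; split=> //; exfalso; lra.
by case: c => /= e; exfalso; lra.
Qed.

Lemma facet_inj p b q c : facet a v p b = facet a v q c -> p = q /\ b = c.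
Proof. by move=> e; apply: facet_center_inj; rewrite -e; apply: facet_center_in. Qed.

(** If a face [F] lies in no facet, take a point [x] of [F] with the largest
number of coordinates strictly between 0 and 1. A coordinate of [x] equal to 0
or 1 could be moved off that value by passing to the midpoint with another point
of [F], so all coordinates of [x] are interior; by extremality [F] then contains
the whole cube. *)
Lemma face_sub_facet F : is_face (cube a v) F -> F <> cube a v ->
  exists p b, F `<=` facet a v p b.
Proof.
move=> /is_faceP[[x0 Fx0] FP cF eF] nF; apply: contrapT => nfac; apply: nF.
have out p (b : bool) : exists2 y, F y & coords a v y 0 p != b%:R.
  apply: contrapT => h; apply: nfac; exists p, b => y Fy; apply/facetE.
  split; first exact: FP.
  by apply/eqP; apply: contrapT => /negP hy; apply: h; exists y.
pose inner x := [set i | 0 < coords a v x 0 i < 1]%SET.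
have [x Fx maxx] : exists2 x, F x & forall y, F y -> (#|inner y| <= #|inner x|)%N.
  have exm : exists m, `[< exists2 x, F x & #|inner x| = m >].
    by exists #|inner x0|; apply/asboolP; exists x0.
  have bnd m : `[< exists2 x, F x & #|inner x| = m >] -> (m <= k.+1)%N.
    by move=> /asboolP[x _ <-]; rewrite -[X in (_ <= X)%N]card_ord max_card.
  case: (ex_maxnP exm bnd) => m /asboolP[x Fx <-] mx.
  by exists x => // y Fy; apply: mx; apply/asboolP; exists y.
have [x01 ex] := (cubeE _ _ rv).1 (FP _ Fx).
have xin i : 0 < coords a v x 0 i < 1.
  apply: contrapT => /negP nx.
  have [b xb] : exists b : bool, coords a v x 0 i = b%:R.
    have := x01 i; have [->|n0] := eqVneq (coords a v x 0 i) 0.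
      by exists false.
    have [->|n1] := eqVneq (coords a v x 0 i) 1; first by exists true.
    move=> /andP[h0 h1]; move: nx; rewrite !lt_neqAle h0 h1 n1 eq_sym n0.
    by [].
  have [y Fy yb] := out i b.
  have h01 : 0 < (2^-1 : R) < 1 by lra.
  have Fz := cF _ _ _ Fx Fy h01; have := maxx _ Fz; apply/negP; rewrite -ltnNge.
  have [y01 _] := (cubeE _ _ rv).1 (FP _ Fy).
  apply: proper_card; apply/properP; split.
    apply/fintype.subsetP => j; rewrite !inE coords_conv => xj.
    by have := y01 j; lra.
  exists i; last by rewrite inE.
  rewrite inE coords_conv xb; have := y01 i; move: yb.
  move: (coords a v y 0 i) => yi; case: (b) => /= /eqP yb yi01.
    have : yi < 1 by rewrite lt_neqAle; apply/andP; split; [exact/eqP | lra].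
    by lra.
  have : 0 < yi by rewrite lt_neqAle eq_sym; apply/andP; split; [exact/eqP | lra].
  by lra.
(* every y of the cube is an end of a segment of the cube passing through x:
   the other end z lies slightly beyond x *)
apply/seteqP; split=> // y Py; have [y01 ey] := (cubeE _ _ rv).1 Py.
move: (coords a v x) (coords a v y) xin ex y01 ey => u w xin ex w01 ey.
have [|e e0 small] := @small_perturbation R ('I_k.+1 * bool)%type
    (fun ib => if ib.2 then 1 - u 0 ib.1 else u 0 ib.1)
    (fun ib => if ib.2 then w 0 ib.1 - u 0 ib.1
               else u 0 ib.1 - w 0 ib.1).
  by move=> [i []] /=; have := xin i; lra.
have {}small i : 0 <= u 0 i + e * (u 0 i - w 0 i) <= 1.
  have ee : 0 < e <= e by rewrite e0 lexx.
  by have := small e ee (i, false); have := small e ee (i, true); rewrite /=; lra.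
pose z := a + (u + e *: (u - w)) *m v.
have Pz : cube a v z.
  by eexists; split; [|reflexivity] => i; rewrite !mxE; apply: small.
have t01 : 0 < e / (1 + e) < 1.
  rewrite divr_gt0 ?addr_gt0 //= ltr_pdivrMr ?addr_gt0 //; lra.
suff [] : F y /\ F z by [].
apply: (eF _ _ _ _ _ t01) => //.
suff -> : e / (1 + e) *: y + (1 - e / (1 + e)) *: z = x by [].
have ne : 1 + e != 0 by rewrite lt0r_neq0 // addr_gt0.
rewrite ex ey /z mulmxDl -scalemxAl mulmxBl.
move: (u *m v) (w *m v) => U W.
by apply/rowP => i; rewrite !mxE; field.
Qed.

End Facets.

Section FacetsOfDim.
Variables (R : realType) (n : nat).

(** A proper face lies in a facet, whose frame has one row less. *)
Lemma proper_face_dim k (a : 'rV[R]_n) (v : 'M[R]_(k, n)) F : row_free v ->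
  is_face (cube a v) F -> has_dim F k -> F = cube a v.
Proof.
case: k v => [|k] v rv cF [B FB].
  case: cF => -[x Fx] FP _ _; apply/seteqP; split=> // y Py.
  case: Py => t [_ ->]; have [u [_ eu]] := FP _ Fx.
  by move: Fx; rewrite eu [t]thinmx0 [u]thinmx0.
apply: contrapT => /(face_sub_facet rv cF)[p [b sF]].
have [_ _ PS _] := cube_frame (a + b%:R *: row p v) (row_free_row' rv p).
case: FB => _ rB _ minB.
have : (B <= row' p v)%MS.
  rewrite -(genmxE (row' p v)); apply: minB => x y Fx Fy.
  by rewrite genmxE; apply: PS; apply: sF.
move/mxrankS; rewrite (eqP rB) => /leq_trans/(_ (rank_leq_row _)).
by rewrite ltnn.
Qed.

Lemma facet_has_dim k (a : 'rV[R]_n) (v : 'M[R]_(k.+1, n)) p b : row_free v ->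
  has_dim (facet a v p b) k.
Proof. by move=> rv; exists (row' p v); apply/cube_frame/row_free_row'. Qed.

(** Identifies the index set of the sum defining the index: by
[face_sub_facet] a face of codimension 1 lies in a facet, and it cannot be a
proper face of that facet for dimension reasons. *)
Lemma cube_faces_of_dim k (a : 'rV[R]_n) (v : 'M[R]_(k.+1, n)) S : row_free v ->
  faces_of_dim (std_polytope (cube a v)) k S <-> exists p b, S = facet a v p b.
Proof.
move=> rv; split=> [[/= PS dS]|[p [b ->]]]; last first.
  by split; [exact: facet_face | exact: facet_has_dim].
have nS : S <> cube a v.
  move=> e; case: dS => B SB; rewrite e in SB.
  by have /eqP := frame_dim SB (cube_frame a rv); rewrite eqn_leq ltnn andbF.
have [p [b Sf]] := face_sub_facet rv PS nS.
exists p, b; apply: proper_face_dim dS; first exact: row_free_row'.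
exact/(face_of_face (facet_face a rv p b)).
Qed.

Lemma facet_of_facet_center k (a : 'rV[R]_n) (v : 'M[R]_(k.+1, n)) p b F :
  row_free v -> is_face (cube a v) F -> F (facet_center a v p b) ->
  facet a v p b `<=` F.
Proof.
move=> rv PF Fx; apply: face_symmetric_center PF _ Fx _; first exact: facet_sub.
by move=> y; apply: cube_reflect.
Qed.

End FacetsOfDim.

(** * Induced orientations *)

Section Orientation.
Variables (R : realType) (n : nat).

Lemma det_insert_row k (u : 'rV[R]_k.+1) p :
  \det (col_mx u (row' p 1%:M) : 'M_(1 + k)) = (-1) ^+ p * u 0 p.
Proof.
have e0 : (ord0 : 'I_(1 + k)) = lshift k ord0 by apply/val_inj.
rewrite (expand_det_col _ p) (bigD1 (ord0 : 'I_(1 + k))) //= big1 ?addr0.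
  have -> : (col_mx u (row' p 1%:M) : 'M_(1 + k, k.+1)) ord0 p = u 0 p.
    by rewrite e0 col_mxEu.
  rewrite mulrC /cofactor (_ : row' _ _ = 1%:M) ?det1 ?mulr1 //.
  apply/matrixP => i j; rewrite 2!mxE.
  have -> : lift (ord0 : 'I_(1 + k)) i = rshift 1 i by apply/val_inj.
  by rewrite (@col_mxEd _ 1 k) !mxE (inj_eq lift_inj).
move=> i; case: (split_ordP (i : 'I_(1 + k))) => j ->.
  by rewrite [j]ord1 e0 eqxx.
by rewrite (@col_mxEd _ 1 k) !mxE => _; rewrite eq_sym (negbTE (neq_lift _ _)) mul0r.
Qed.

(** Replacing row [p] of a frame [v] by a vector [u *m v] put on top multiplies
the orientation by [(-1) ^+ p] times the sign of the [p]-th coordinate of that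
vector: all orientation comparisons below reduce to this. *)
Lemma det_facet_frame k (v : 'M[R]_(k.+1, n)) p (u : 'rV_k.+1) (A : 'M_k)
    (M : 'M_(1 + k)) : row_free v ->
  col_mx (u *m v) (A *m row' p v) = M *m v ->
  \det M = (-1) ^+ p * u 0 p * \det A.
Proof.
move=> rv e.
have er : row' p v = row' p 1%:M *m v.
  by rewrite row'Esub rowsubE -row'Esub.
have -> : M = block_mx 1%:M 0 0 A *m (col_mx u (row' p 1%:M)).
  apply: (row_free_inj rv); rewrite /= -e er -mulmxA (mul_col_mx u) mul_block_col.
  by rewrite !mul0mx !mul1mx addr0 add0r mulmxA.
by rewrite det_mulmx det_ublock det1 mul1r det_insert_row mulrC.
Qed.

(** An induced frame exists because the sign of any frame of [S] can be corrected
by rescaling one of its rows. This requires a row, hence [0 < k]: a point has a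
single frame and cannot be reoriented. *)
Lemma induced_frameP k (P : set 'rV[R]_n) (B : 'M[R]_(k.+1, n)) S
    (beta : 'M[R]_(k, n)) s p (M : 'M[R]_k.+1) : (0 < k)%N ->
  is_frame S beta -> S s -> P p -> col_mx (s - p) beta = M *m B ->
  \det M != 0 -> induces P B S (induced_frame P B S).
Proof.
case: k B beta M => // k B beta M _ Sbeta Ss Pp eM M0; apply: xgetPex.
pose D : 'M[R]_(1 + k) := block_mx (\det M)%:M 0 0 1%:M.
have detD : \det D = \det M by rewrite det_ublock det1 mulr1 det_scalar1.
exists (D *m beta); split.
  by apply: is_frameM Sbeta; rewrite unitmxE detD unitfE.
exists s, p, (block_mx (1%:M : 'M_1) 0 0 D *m M); split=> //.
  by rewrite det_mulmx (@det_ublock _ 1 k.+1) det1 mul1r detD -expr2 exprn_even_gt0.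
rewrite -mulmxA -eM (@mul_block_col _ 1 k.+1 1 k.+1).
by rewrite !mul0mx mul1mx addr0 add0r.
Qed.

(** Incidence number of an oriented cube and its facet [t p = b], both oriented
by their standard frames: the outward vector is the row [p] if [b = 1] and its
opposite if [b = 0]. *)
Definition fsign k (p : 'I_k.+1) (b : bool) : int := (-1) ^+ (p + ~~ b).

Lemma sgz_fsign k (p : 'I_k.+1) (b : bool) (c : R) :
  0 <= c <= 1 -> c != b%:R -> sgz ((-1) ^+ p * (b%:R - c)) = fsign p b.
Proof.
move=> c01 cb; rewrite sgzM sgzX sgzN1 /fsign exprD; congr (_ * _).
case: b cb => /= cb.
  by rewrite gtr0_sgz // subr_gt0 lt_neqAle cb; lra.
by rewrite expr1 ltr0_sgz // subr_lt0 lt_neqAle eq_sym cb; lra.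
Qed.

Lemma row_subE k (x y : 'rV[R]_k) i : (x - y) 0 i = x 0 i - y 0 i.
Proof. by rewrite !mxE. Qed.

Lemma coords_sub k (a : 'rV[R]_n) (v : 'M[R]_(k, n)) x y : row_free v ->
  cube a v x -> cube a v y -> x - y = (coords a v x - coords a v y) *m v.
Proof.
move=> rv /(cubeE _ _ rv)[_ {1}->] /(cubeE _ _ rv)[_ {1}->].
by rewrite opprD addrACA subrr add0r mulmxBl.
Qed.

Lemma facet_side k (a : 'rV[R]_n) (v : 'M[R]_(k.+1, n)) p b (D : 'M[R]_k)
    (M : 'M[R]_(1 + k)) s q : row_free v ->
  facet a v p b s -> cube a v q ->
  col_mx (s - q) (D *m row' p v) = M *m v -> \det M != 0 ->
  sgz (\det M) = fsign p b * sgz (\det D).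
Proof.
move=> rv /(facetE a rv)[Ps es] Pq; rewrite (coords_sub rv Ps Pq) => e M0.
have [/(_ p) q01 _] := (cubeE _ _ rv).1 Pq.
have dM := det_facet_frame rv e; move: M0 dM; rewrite row_subE es => M0 dM.
rewrite dM sgzM sgz_fsign //; apply: contraNneq M0 => qb.
by rewrite dM qb subrr mulr0 mul0r.
Qed.

Lemma facet_inducible k (a : 'rV[R]_n) (v : 'M[R]_(k.+1, n)) p b :
  row_free v -> exists s q (M : 'M[R]_(1 + k)),
  [/\ facet a v p b s, cube a v q, col_mx (s - q) (row' p v) = M *m v &
      \det M != 0].
Proof.
move=> rv; exists (facet_center a v p b), (facet_center a v p (~~ b)).
have Fs := facet_center_in a v p b.
have Fq := facet_center_in a v p (~~ b).
have Ps : cube a v (facet_center a v p b) by apply: facet_sub Fs.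
have Pq : cube a v (facet_center a v p (~~ b)) by apply: facet_sub Fq.
pose u : 'rV[R]_k.+1 := coords a v (facet_center a v p b) - coords a v (facet_center a v p (~~ b)).
exists (col_mx u (row' p 1%:M)); split=> //.
  rewrite mul_col_mx -(coords_sub rv) //.
  by congr col_mx; rewrite row'Esub rowsubE.
rewrite det_insert_row mulf_neq0 ?signr_eq0 // /u row_subE.
rewrite !coords_facet_center // eqxx; by case: (b); rewrite /= ?subr0 ?sub0r ?oppr_eq0 oner_eq0.
Qed.

(** Translates the orientation chosen by the definition of the index into the
incidence number: the induced frame need not be the standard one, but its sign
relative to the standard frame is forced. *)
Lemma facet_induced k (a : 'rV[R]_n) (v : 'M[R]_(k.+2, n)) (A : 'M[R]_k.+2) p b :
  row_free v -> A \in unitmx ->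
  exists2 D, D \in unitmx &
    induced_frame (cube a v) (A *m v) (facet a v p b) = D *m row' p v /\
    fsign p b * sgz (\det D) = sgz (\det A).
Proof.
move=> rv uA; have Ff := cube_frame (a + b%:R *: row p v) (row_free_row' rv p).
have [s [q [M [Ss Pq eM M0]]]] := facet_inducible a p b rv.
have : induces (cube a v) (A *m v) (facet a v p b)
         (induced_frame (cube a v) (A *m v) (facet a v p b)).
  apply: (@induced_frameP _ _ _ _ (row' p v) s q (M *m invmx A)) => //.
    by rewrite mulmxA mulmxKV.
  by rewrite det_mulmx mulf_neq0 // -unitfE -unitmxE unitmx_inv.
set B' := induced_frame _ _ _ => -[FB' [s' [q' [M' [Ss' Pq' M'0 eM']]]]].
have [D uD eD] := frame_change FB' Ff; exists D => //; split=> //.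
have dA : \det A != 0 by rewrite -unitfE -unitmxE.
rewrite -(@facet_side _ a v p b D (M' *m A) s' q') //.
- by rewrite det_mulmx sgzM gtr0_sgz // mul1r.
- by rewrite -eD eM' mulmxA.
by rewrite det_mulmx mulf_neq0 // lt0r_neq0.
Qed.

End Orientation.

(** * The index of a cube as a sum over its facets *)

Lemma fsbig_finType (T : finType) (J : choiceType) (P : pred T) (h : T -> J)
    (Q : set J) (G : J -> int) :
  (forall t, P t -> Q (h t)) ->
  (forall t u, P t -> P u -> h t = h u -> t = u) ->
  (forall j, Q j -> exists2 t, P t & j = h t) ->
  \sum_(j \in Q) G j = \sum_(t | P t) G (h t).
Proof.
move=> PQ hinj hsurj; rewrite (@reindex_fsbig _ _ _ _ _ h [set t | P t]).
  rewrite fsbig_finite; last exact: finite_finset.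
  rewrite -[RHS]big_filter; apply: perm_big; apply: uniq_perm.
  - exact: finmap.fset_uniq.
  - by rewrite filter_uniq // index_enum_uniq.
  move=> t; rewrite in_fset_set ?mem_filter; last exact: finite_finset.
  rewrite mem_index_enum andbT.
  by apply/idP/idP; rewrite inE.
split=> // [t u /set_mem Pt /set_mem Pu|j /hsurj[t Pt ->]]; first exact: hinj.
by exists t.
Qed.

Section Index.
Variables (R : realType) (n : nat) (f : 'rV[R]_n -> nat).

(** The index of a segment is [f x == 1] at its origin minus the same at its
end, i.e. the opposite of the sum over its boundary with outward signs. With the
sign -1 in dimension 0, the passage from dimension 0 to 1 follows the same rule
as in the higher dimensions. *)
Definition oind k (P : set 'rV[R]_n) (B : 'M[R]_(k, n)) : int :=
  (if k == 0%N then -1 else 1) * ind f (std_polytope P) B.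

Definition full_labels k (P : polytope R n) : Prop :=
  f @` vertices P = [set j | (1 <= j <= k.+1)%N].

Lemma ind_full k (P : polytope R n) (B : 'M[R]_(k, n)) :
  ind f P B != 0 -> full_labels k P.
Proof.
case: k B => [|k] B /=.
  case: asboolP => // e _; rewrite /full_labels e; apply/seteqP.
  by split=> j /=; [move=> ->|move=> h; apply/eqP; rewrite eqn_leq andbC].
by case: asboolP.
Qed.

Lemma ind_facets k (P : polytope R n) (B : 'M[R]_(k.+1, n)) : (0 < k)%N ->
  ind f P B = if `[< full_labels k.+1 P >] then
    \sum_(S \in faces_of_dim P k)
      ind f (face_polytope P S) (induced_frame (body P) B S) else 0.
Proof. by case: k B => // k B _; rewrite -if_neg. Qed.

Lemma ind_vertices (P Q : polytope R n) (B : 'M[R]_(1, n)) :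
  vertices P = vertices Q -> ind f P B = ind f Q B.
Proof. by move=> e; rewrite /= e. Qed.

Lemma fsbig_facets k (a : 'rV[R]_n) (v : 'M[R]_(k.+1, n)) (G : set 'rV[R]_n -> int) :
  row_free v ->
  \sum_(S \in faces_of_dim (std_polytope (cube a v)) k) G S =
  \sum_(t : 'I_k.+1 * bool) G (facet a v t.1 t.2).
Proof.
move=> rv; apply: fsbig_finType => [[p b] _|[p b] [q c] _ _|S].
- by apply/(cube_faces_of_dim _ _ rv); exists p, b.
- by move=> /(facet_inj rv)/= [-> ->].
by move=> /(cube_faces_of_dim _ _ rv)[p [b ->]]; exists (p, b).
Qed.

(** When the labels are exactly 1 and 2, the sign in the definition of the index
depends only on which of the two vertices carries 1. *)
Lemma ind_segment (P : polytope R n) x y (c : R) (B : 'M[R]_(1, n)) :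
  vertices P = [set x; y] -> row_free B -> y - x = c *: row ord0 B -> c != 0 ->
  full_labels 1 P -> ind f P B = sgz c * ((f x == 1%N)%:Z - (f y == 1%N)%:Z).
Proof.
move=> Vxy rB eB c0 Pfull; rewrite /= asboolT //=.
have B0 : row ord0 B != 0.
  by apply: contraTneq rB => B0; rewrite /row_free (_ : B = 0) ?mxrank0 //;
     apply/row_matrixP => i; rewrite [i]ord1 B0 row0.
have rcan c1 c2 : c1 *: row ord0 B = c2 *: row ord0 B -> c1 = c2.
  move=> /eqP; rewrite -subr_eq0 -scalerBl scaler_eq0 (negbTE B0) orbF.
  by rewrite subr_eq0 => /eqP.
have lab z : vertices P z -> f z = 1%N \/ f z = 2%N.
  move=> Vz; have : full_labels 1 P by []. rewrite /full_labels => e.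
  have : (f @` vertices P) (f z) by exists z.
  by rewrite e /=; case: (f z) => [|[|[|?]]] //; [left|right].
have [Vx Vy] : vertices P x /\ vertices P y by rewrite Vxy; split; [left|right].
have hit j : (1 <= j <= 2)%N -> f x = j \/ f y = j.
  move=> j12; have : (f @` vertices P) j by rewrite Pfull.
  by rewrite Vxy => -[z [->|->]]; [left|right].
have [fx|fx] := lab _ Vx.
  have fy : f y = 2%N by case: (hit 2%N) => // e; rewrite e in fx.
  rewrite fx fy /= subr0 mulr1; case: asboolP => [[x' [y' [d [[Vx' fx'] [Vy' fy'] d0 e]]]]|h].
    have -> : c = d; last by rewrite gtr0_sgz.
    move: Vx' Vy'; rewrite Vxy => -[/= ?|/= ?]; subst x'; last by rewrite fy in fx'.
    by move=> [/= ?|/= ?]; subst y'; [rewrite fx in fy'| apply: rcan; rewrite -e].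
  rewrite ltr0_sgz // lt_neqAle c0 leNgt; apply/negP => c1; apply: h.
  by exists x, y, c.
have fy : f y = 1%N by case: (hit 1%N) => // e; rewrite e in fx.
rewrite fx fy /= sub0r mulrN1; case: asboolP => [[x' [y' [d [[Vx' fx'] [Vy' fy'] d0 e]]]]|h].
  have -> : c = - d; last by rewrite sgzN gtr0_sgz.
  move: Vx' Vy'; rewrite Vxy => -[/= ?|/= ?]; subst x'; first by rewrite fx in fx'.
  move=> [/= ?|/= ?]; subst y'; last by rewrite fy in fy'.
  by apply: rcan; rewrite scaleNr -e opprB.
rewrite gtr0_sgz // lt_neqAle eq_sym c0 leNgt; apply/negP => c1; apply: h.
by exists y, x, (- c); split; rewrite // ?oppr_gt0 // scaleNr -eB opprB.
Qed.

End Index.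

Section CubeIndex.
Variables (R : realType) (n : nat) (f : 'rV[R]_n -> nat).

Lemma cube0 (a : 'rV[R]_n) (v : 'M[R]_(0, n)) : cube a v = [set a].
Proof.
apply/seteqP; split=> [x [t [_ ->]]|x ->] /=.
  by rewrite [t]thinmx0 mul0mx addr0.
by exists 0; rewrite mul0mx addr0; split=> // -[].
Qed.

Lemma cube_face_refl k (a : 'rV[R]_n) (v : 'M[R]_(k, n)) : row_free v ->
  is_face (cube a v) (cube a v).
Proof.
move=> rv; apply/is_faceP; split=> //; first by exists (center a v); apply: cube_center.
by move=> x y t; apply: cube_conv.
Qed.

Lemma row_free0 (v : 'M[R]_(0, n)) : row_free v.
Proof. by rewrite /row_free [v]flatmx0 mxrank0. Qed.

Lemma set1_dim0 (x : 'rV[R]_n) : has_dim [set x] 0.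
Proof. by exists 0; rewrite -(cube0 x 0); apply/cube_frame/row_free0. Qed.

Lemma vertices_set1 (x : 'rV[R]_n) : vertices (std_polytope [set x]) = [set x].
Proof.
apply/seteqP; split=> y /=; rewrite /vertices /=.
  by case=> _ /(_ y) yx _ _; apply: yx.
move=> ->; rewrite -{1 2}(cube0 x 0); apply: cube_face_refl; exact: row_free0.
Qed.

Lemma vertices_face (P F : set 'rV[R]_n) : is_face P F ->
  vertices (std_polytope F) `<=` vertices (std_polytope P).
Proof.
move=> PF x; rewrite /vertices /= => Fx.
have xF : [set x] `<=` F by case: Fx.
exact/(face_of_face PF xF).
Qed.

Lemma segment_vertices (a : 'rV[R]_n) (v : 'M[R]_(1, n)) : row_free v ->
  vertices (std_polytope (cube a v)) = [set a; a + row ord0 v].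
Proof.
move=> rv; have fac p b : facet a v p b = [set a + b%:R *: row ord0 v].
  by rewrite /facet cube0 [p]ord1.
apply/seteqP; split=> x; rewrite /vertices /=.
  move=> Px; have : faces_of_dim (std_polytope (cube a v)) 0 [set x].
    by split=> //; apply: set1_dim0.
  move=> /(cube_faces_of_dim _ _ rv)[p [b]]; rewrite fac.
  move=> /seteqP[/(_ x erefl) /= ->] _.
  by case: b; rewrite ?scale0r ?scale1r ?addr0; [right|left].
move=> xE; have [b xb] : exists b : bool, x = a + b%:R *: row ord0 v.
  case: xE => /= ->; first by exists false; rewrite scale0r addr0.
  by exists true; rewrite scale1r.
by rewrite xb -(fac ord0); apply: facet_face.
Qed.

Lemma oind_set1 (x : 'rV[R]_n) (B : 'M[R]_(0, n)) :
  oind f [set x] B = - (f x == 1%N)%:Z.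
Proof.
rewrite /oind /= vertices_set1 mulN1r; congr (- _).
case: asboolP => [/seteqP[/(_ (f x))/= h _]|h].
  by rewrite h ?eqxx //; exists x.
case: eqP => // fx; case: h; apply/seteqP; split=> [_ [y -> <-] //|y /= ->].
by exists x.
Qed.

Definition facet_sum k (a : 'rV[R]_n) (v : 'M[R]_(k.+1, n)) : int :=
  \sum_(t : 'I_k.+1 * bool)
     fsign t.1 t.2 * oind f (facet a v t.1 t.2) (row' t.1 v).

Lemma oindS k P (B : 'M[R]_(k, n)) : (0 < k)%N ->
  oind f P B = ind f (std_polytope P) B.
Proof. by rewrite /oind lt0n => /negPf ->; rewrite mul1r. Qed.

Lemma facet_sum_segment (a : 'rV[R]_n) (v : 'M[R]_(1, n)) :
  facet_sum a v = (f a == 1%N)%:Z - (f (a + row ord0 v) == 1%N)%:Z.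
Proof.
rewrite /facet_sum.
rewrite -(pair_bigA _ (fun p b => fsign p b * oind f (facet a v p b) (row' p v))) /=.
rewrite big_ord1 big_bool /facet !cube0 !oind_set1 scale0r scale1r addr0 /fsign.
by rewrite /= !addn0; ring.
Qed.

(** Expansion along the facets together with the dependence on the frame. The two
are proved at once: changing the frame of the cube by [A] changes the induced
frame of each facet by a matrix with the same determinant sign, so the induction
hypothesis for the facets yields the factor [sgz (\det A)]. *)
Lemma ind_cubeM k (a : 'rV[R]_n) (v : 'M[R]_(k.+1, n)) (A : 'M[R]_k.+1) :
  row_free v -> A \in unitmx ->
  ind f (std_polytope (cube a v)) (A *m v) =
  if `[< full_labels f k.+1 (std_polytope (cube a v)) >]
  then sgz (\det A) * facet_sum a v else 0.
Proof.
elim: k a v A => [|k IH] a v A rv uA.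
  case: asboolP => [Pf|nPf]; last by rewrite /= asboolF.
  have A0 : A ord0 ord0 != 0 by rewrite -det_mx11 -unitfE -unitmxE.
  rewrite (ind_segment (segment_vertices a rv) (c := (A ord0 ord0)^-1)) //.
  - have -> : sgz (A ord0 ord0)^-1 = sgz (A ord0 ord0).
      by rewrite /sgz invr_eq0 invr_lt0.
    by rewrite det_mx11 facet_sum_segment.
  - exact: row_free_unitM.
  - rewrite addrC addKr [in RHS](mx11_scalar A) mul_scalar_mx linearZ /=.
    by rewrite mxE eqxx mulr1n scalerA mulVf ?scale1r.
  by rewrite invr_eq0.
rewrite ind_facets //; case: asboolP => // _; rewrite fsbig_facets // /facet_sum mulr_sumr.
apply: eq_bigr => -[p b] _; rewrite [(p, b).1]/= [(p, b).2]/=.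
rewrite [body _]/=; have [D uD [-> eD]] := facet_induced a p b rv uA.
rewrite face_polytope_std; last exact: facet_face.
have rp := row_free_row' rv p.
rewrite oindS //; have e1 := IH (a + b%:R *: row p v) _ _ rp uD.
have := IH (a + b%:R *: row p v) _ _ rp (unitmx1 _ _).
rewrite mul1mx det1 sgz1 mul1r => e2.
rewrite [LHS]e1 [ind _ _ (row' p v)]e2 -eD.
have f2 : fsign p b * fsign p b = 1 by rewrite -expr2 sqrr_sign.
by case: ifP => _; rewrite ?mulr0 // mulrACA f2 mul1r.
Qed.

Lemma oind_cube k (a : 'rV[R]_n) (v : 'M[R]_(k.+1, n)) : row_free v ->
  oind f (cube a v) v =
  if `[< full_labels f k.+1 (std_polytope (cube a v)) >]
  then facet_sum a v else 0.
Proof.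
move=> rv; have := ind_cubeM a rv (unitmx1 _ _).
by rewrite mul1mx det1 sgz1 mul1r oindS.
Qed.

Lemma oindM k (a : 'rV[R]_n) (v : 'M[R]_(k, n)) (A : 'M[R]_k) :
  row_free v -> A \in unitmx ->
  oind f (cube a v) (A *m v) = sgz (\det A) * oind f (cube a v) v.
Proof.
case: k v A => [|k] v A rv uA; first by rewrite det_mx00 sgz1 mul1r [v]flatmx0 mulmx0.
rewrite oind_cube // oindS // ind_cubeM //.
by case: ifP; rewrite ?mulr0.
Qed.

Lemma oind_full k P (B : 'M[R]_(k, n)) : oind f P B != 0 ->
  full_labels f k (std_polytope P).
Proof. by rewrite /oind; case: ifP => _ h; apply: (@ind_full _ _ _ _ _ B); apply: contraNneq h => ->; rewrite mulr0. Qed.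

End CubeIndex.

(** * Vanishing of the sum over the facets when a label is missing *)

Lemma sum_sign_reversing (T : finType) (P : pred T) (F : T -> int) (tau : T -> T) :
  (forall t, P t -> P (tau t)) -> (forall t, P t -> tau (tau t) = t) ->
  (forall t, P t -> F (tau t) = - F t) -> \sum_(t | P t) F t = 0.
Proof.
move=> Ptau tauK Ftau; have : \sum_(t | P t) F t = - \sum_(t | P t) F t.
  rewrite -sumrN [LHS](reindex_onto tau tau) //.
  apply: eq_big => [t|t /andP[Pt /eqP e]]; last first.
    by apply: Ftau; rewrite -e; apply: Ptau.
  by apply/andP/idP => [[/Ptau]|Pt]; [move=> + /eqP e; rewrite e | rewrite tauK ?Ptau].
lia.
Qed.

Section Boundary.
Variables (R : realType) (n : nat) (f : 'rV[R]_n -> nat).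

(** Deleting [p] and then the index [q] among the remaining ones deletes the pair
[{p, lift p q}]. Deleting it in the other order gives the same rows, and the
exponents of the two signs differ by one. *)
Lemma lift_swap k (p : 'I_k.+2) (q : 'I_k.+1) :
  exists q' : 'I_k.+1, [/\ unlift (lift p q) p = Some q',
    lift (lift p q) q' = p,
    forall i : 'I_k, lift p (lift q i) = lift (lift p q) (lift q' i) &
    (-1) ^+ lift p q * (-1) ^+ q' = - ((-1) ^+ p * (-1) ^+ q) :> int].
Proof.
have /unlift_some[q' e uq'] : lift p q != p by rewrite eq_sym neq_lift.
exists q'; split=> //.
  move=> i; apply/val_inj; rewrite /= bumpC; congr bump; congr bump.
  have /(congr1 val) /= ev := e.
  by move: ev; rewrite /unbump /bump; lia.
rewrite -!exprD -[RHS]mulN1r -exprS -signr_odd -[RHS]signr_odd; congr (_ ^+ nat_of_bool _).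
have /(congr1 val) /= := e; rewrite /bump; lia.
Qed.

(** The boundary of a boundary is zero: a face of codimension 2 is reached
through exactly two facets, with opposite signs. *)
Lemma facet_sum_boundary k (a : 'rV[R]_n) (v : 'M[R]_(k.+2, n)) :
  \sum_(t : 'I_k.+2 * bool) fsign t.1 t.2 *
    facet_sum f (a + t.2%:R *: row t.1 v) (row' t.1 v) = 0.
Proof.
under eq_bigr do rewrite mulr_sumr.
rewrite pair_bigA /=.
pose unl (h i : 'I_k.+2) : 'I_k.+1 := odflt ord0 (unlift h i).
(* exchange the order in which the two coordinates are fixed *)
apply: (@sum_sign_reversing _ _ _ (fun x =>
  ((lift x.1.1 x.2.1, x.2.2), (unl (lift x.1.1 x.2.1) x.1.1, x.1.2)))) => //.
  move=> [[p b] [q c]] _ /=; have [q' [e lq _ _]] := lift_swap p q.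
  by rewrite /unl e /= lq liftK.
move=> [[p b] [q c]] _ /=; have [q' [e lq e2 e3]] := lift_swap p q.
rewrite /unl e /=.
have er i : row i (row' p v) = row (lift p i) v by apply/rowP => j; rewrite !mxE.
have er' i : row i (row' (lift p q) v) = row (lift (lift p q) i) v.
  by apply/rowP => j; rewrite !mxE.
rewrite /facet er er' lq [_ + c%:R *: _ + _]addrAC.
have -> : row' q' (row' (lift p q) v) = row' q (row' p v).
  by apply/matrixP => i j; rewrite !mxE e2.
move: (oind f _ _) => X; rewrite !mulrA -[RHS]mulNr; congr (_ * X).
rewrite /fsign; do 4!rewrite [(-1) ^+ (_ + nat_of_bool _)]exprD.
rewrite mulrACA e3 mulNr [in RHS]mulrACA; congr (- (_ * _)).
exact: mulrC.
Qed.

Lemma facet_vertices k (a : 'rV[R]_n) (v : 'M[R]_(k.+1, n)) p b : row_free v ->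
  vertices (std_polytope (facet a v p b)) `<=` vertices (std_polytope (cube a v)).
Proof. by move=> rv; apply/vertices_face/facet_face. Qed.

(** A label required on the facets is missing, so no facet carries all the labels
that a nonzero index would require. *)
Lemma facet_sum_missing k (a : 'rV[R]_n) (v : 'M[R]_(k.+1, n)) j : row_free v ->
  (1 <= j <= k.+1)%N ->
  ~ (f @` vertices (std_polytope (cube a v))) j -> facet_sum f a v = 0.
Proof.
move=> rv jk nj; apply: big1 => -[p b] _ /=; apply/eqP; rewrite mulf_eq0.
apply/orP; right; apply: contrapT => /negP/oind_full ful; apply: nj.
have : [set j | (1 <= j <= k.+1)%N] j by [].
by rewrite -ful => -[x Fx <-]; exists x => //; apply: facet_vertices Fx.
Qed.

(** Within the admissible range of labels, the expansion along the facets also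
holds when a label is missing, both sides being zero. If the largest label [k.+2] is the missing one,
the facets have their labels in the range of their own dimension; expanding them
by induction leaves a boundary of a boundary. *)
Lemma oind_facet_sum k (a : 'rV[R]_n) (v : 'M[R]_(k.+1, n)) : row_free v ->
  (forall x, vertices (std_polytope (cube a v)) x -> (1 <= f x <= k.+2)%N) ->
  oind f (cube a v) v = facet_sum f a v.
Proof.
elim: k a v => [|k IH] a v rv lab; rewrite oind_cube //;
  case: asboolP => // nfull; apply/esym.
  have Pv : vertices (std_polytope (cube a v)) = [set a; a + row ord0 v].
    exact: segment_vertices.
  rewrite facet_sum_segment; have := lab a; have := lab (a + row ord0 v); rewrite Pv.
  move=> /(_ (or_intror erefl)) l1 /(_ (or_introl erefl)) l0.
  apply: contrapT => ne; apply: nfull; rewrite /full_labels Pv.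
  apply/seteqP; split=> [_ [x [->|->] <-]|j] //=.
  move=> j12; have : f a = j \/ f (a + row ord0 v) = j.
    move: ne l0 l1; case: eqP; case: eqP => // e1 e0 _; lia.
  by case=> <-; eexists; [left| |right|].
have [j jk nj] : exists2 j, (1 <= j <= k.+3)%N &
    ~ (f @` vertices (std_polytope (cube a v))) j.
  apply: contrapT => h; apply: nfull; apply/seteqP; split=> [_ [x Px <-]|j jk] /=.
    exact: lab.
  by apply: contrapT => nj; apply: h; exists j.
(* a missing label other than the largest one is also missing on the facets *)
have [jk'|jk'] := leqP j k.+2.
  by apply: (@facet_sum_missing _ _ _ j) => //; case/andP: jk => ->.
rewrite -[RHS](facet_sum_boundary a v); apply: eq_bigr => -[p b] _ /=.
congr (_ * _); apply: IH => [|x Fx]; first exact: row_free_row'.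
have Px := facet_vertices rv Fx.
have fxj : f x <> j by move=> e; apply: nj; exists x.
have := lab _ Px; lia.
Qed.

End Boundary.

(** * Sides of a wall *)

Section Side.
Variables (R : realType) (m : nat).
Implicit Types (a : 'rV[R]_m.+1) (v : 'M[R]_m.+1) (beta : 'M[R]_(m, m.+1)).

(** For [beta] a frame of a hyperplane through [s], [side beta (s - y)] is an
equation of that hyperplane in the variable [y]. *)
Definition side beta (z : 'rV[R]_m.+1) : R := \det (col_mx z beta : 'M_(1 + m)).

Lemma sideZ beta e z : side beta (e *: z) = e * side beta z.
Proof.
rewrite /side; have -> : col_mx (e *: z) beta =
    block_mx (e%:M : 'M_1) 0 0 1%:M *m (col_mx z beta : 'M_(1 + m, 1 + m)).
  by rewrite mul_block_col mul_scalar_mx !mul0mx mul1mx addr0 add0r.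
by rewrite det_mulmx det_ublock det1 mulr1 det_scalar1.
Qed.

Lemma coords_decomp v x a : row_free v -> x = a + coords a v x *m v.
Proof.
move=> rv; rewrite /coords mulmxKpV ?[a + _]addrC ?subrK //.
by rewrite submx_full // row_full_unit -row_free_unit.
Qed.

Lemma row_free_det_neq0 v : row_free v -> \det v != 0.
Proof. by rewrite row_free_unit unitmxE unitfE. Qed.

(** Along a cube having the wall in one of its facets, the equation of the wall is
a multiple of the coordinate that is constant on this facet. So each cube lies on
one side of the hyperplanes of its facets. *)
Lemma side_facet a v p (b : bool) S beta : row_free v -> is_frame S beta ->
  S `<=` facet a v p b -> exists2 kappa, kappa != 0 &
    forall s y, facet a v p b s ->
      side beta (s - y) = kappa * (b%:R - coords a v y 0 p).
Proof.
move=> rv Sb SF; have Ff := cube_frame (a + b%:R *: row p v) (row_free_row' rv p).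
have [_ rb _ _] := Sb.
have [D uD eD] := row_free_change rb (eqmx_sym (frame_trans Ff Sb SF)).
have uv : v \in unitmx by rewrite -row_free_unit.
exists ((-1) ^+ p * \det D * \det v).
  by rewrite !mulf_neq0 ?signr_eq0 ?row_free_det_neq0 // -unitfE -unitmxE.
move=> s y /(facetE _ rv)[_ es].
have e : s - y = (coords a v s - coords a v y) *m v.
  rewrite {1}(coords_decomp s a rv) {1}(coords_decomp y a rv).
  by rewrite opprD addrACA subrr add0r mulmxBl.
have := @det_facet_frame R _ _ v p (coords a v s - coords a v y) D
  ((col_mx (s - y) beta : 'M_(1 + m)) *m invmx v) rv.
rewrite -e -eD mulmxKV // => /(_ erefl).
rewrite det_mulmx det_inv row_subE es => h.
have dv := row_free_det_neq0 rv.
by rewrite /side -(mulfVK dv (\det _)) h; ring.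
Qed.

Lemma side_same_sign a v p (b : bool) S beta s s' y y' : row_free v ->
  is_frame S beta -> S `<=` facet a v p b -> S s -> S s' ->
  cube a v y -> cube a v y' -> 0 <= side beta (s - y) * side beta (s' - y').
Proof.
move=> rv Sb SF Ss Ss' Py Py'; have [k k0 E] := side_facet rv Sb SF.
rewrite !E; try exact: SF.
have [/(_ p) h _] := (cubeE _ _ rv).1 Py.
have [/(_ p) h' _] := (cubeE _ _ rv).1 Py'.
rewrite mulrACA -expr2; apply: mulr_ge0; first exact: sqr_ge0.
by case: (b) => /=; nra.
Qed.

Lemma side_center a v p (b : bool) S beta s : row_free v ->
  is_frame S beta -> S `<=` facet a v p b -> S s ->
  side beta (s - center a v) != 0.
Proof.
move=> rv Sb SF Ss; have [k k0 E] := side_facet rv Sb SF.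
rewrite E; last exact: SF.
by rewrite mulf_neq0 // coords_center //; case: (b) => /=; apply/eqP; lra.
Qed.

Lemma sgz_same (x y : R) : 0 <= x * y -> x != 0 -> y != 0 -> sgz x = sgz y.
Proof.
move=> xy x0 y0; have [hx|hx|hx] := ltgtP x 0; last by rewrite hx eqxx in x0.
  have hy : y < 0 by rewrite lt_neqAle y0 -(nmulr_rge0 _ hx).
  by rewrite !ltr0_sgz.
have hy : 0 < y by rewrite lt_neqAle eq_sym y0 -(pmulr_rge0 _ hx).
by rewrite !gtr0_sgz.
Qed.

Lemma side_sgz a v p (b : bool) S beta s s' y y' : row_free v ->
  is_frame S beta -> S `<=` facet a v p b -> S s -> S s' ->
  cube a v y -> cube a v y' -> side beta (s - y) != 0 ->
  side beta (s' - y') != 0 -> sgz (side beta (s - y)) = sgz (side beta (s' - y')).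
Proof.
move=> rv Sb SF Ss Ss' Py Py'; have := side_same_sign rv Sb SF Ss Ss' Py Py'.
by move=> h n0 n0'; apply: sgz_same h n0 n0'.
Qed.

(** The term of the facet [(p, b)] in the index of the full-dimensional cube
[cube a v] oriented by [B]; the factor [sgz (\det B) * sgz (\det v)] compares [B]
with the standard frame of the cube. *)
Definition contrib (f : 'rV[R]_m.+1 -> nat) (B v : 'M[R]_m.+1) a p b : int :=
  sgz (\det B) * sgz (\det v) *
    (fsign p b * oind f (facet a v p b) (row' p v)).

Lemma sgz_sqr (x : R) : x != 0 -> sgz x * sgz x = 1.
Proof. by case: ltgtP => // h _; [rewrite ltr0_sgz | rewrite gtr0_sgz]. Qed.

(** The contribution in terms of the wall alone: the position of the cube enters
only through the side of the wall on which the cube lies. It makes the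
contributions of different cubes to a common wall comparable. *)
Lemma contribE f B v a p b beta s y : row_free v ->
  is_frame (facet a v p b) beta -> facet a v p b s -> cube a v y ->
  side beta (s - y) != 0 ->
  contrib f B v a p b = sgz (\det B) * sgz (side beta (s - y)) *
                        oind f (facet a v p b) beta.
Proof.
move=> rv Fb Fs Py s0; have rp := row_free_row' rv p.
have [D uD eD] := frame_change Fb (cube_frame (a + b%:R *: row p v) rp).
have uv : v \in unitmx by rewrite -row_free_unit.
have dv := row_free_det_neq0 rv.
have dD : \det D != 0 by rewrite -unitfE -unitmxE.
have := @facet_side R _ _ a v p b D ((col_mx (s - y) beta : 'M_(1 + m)) *m invmx v)
  s y rv Fs Py.
rewrite -eD mulmxKV // => /(_ erefl).
rewrite det_mulmx det_inv mulf_neq0 ?invr_eq0 // => /(_ isT).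
rewrite sgzM (_ : sgz (\det v)^-1 = sgz (\det v)); last first.
  by rewrite /sgz invr_eq0 invr_lt0.
rewrite -/(side beta (s - y)) => e.
have e' : sgz (side beta (s - y)) = sgz (\det v) * (fsign p b * sgz (\det D)).
  by rewrite -e mulrC -mulrA sgz_sqr // mulr1.
rewrite /contrib e' [in RHS]eD [in RHS]/facet oindM // -/(facet a v p b).
have := sgz_sqr dD; move: (sgz (\det D)) => d dd.
set X := oind _ _ _; rewrite -[in LHS](mul1r X) -dd; ring.
Qed.

Lemma contrib_sum f B v a : row_free v ->
  \sum_(t : 'I_m.+1 * bool) contrib f B v a t.1 t.2 =
  sgz (\det B) * sgz (\det v) * facet_sum f a v.
Proof. by rewrite -mulr_sumr. Qed.

Lemma ind_contrib f B v a : row_free v -> B \in unitmx ->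
  (forall x, (1 <= f x <= m.+2)%N) ->
  ind f (std_polytope (cube a v)) B =
  \sum_(t : 'I_m.+1 * bool) contrib f B v a t.1 t.2.
Proof.
move=> rv uB lab; have uv : v \in unitmx by rewrite -row_free_unit.
rewrite contrib_sum // -oind_facet_sum // -oindS //.
rewrite -{1}(mulmxKV uv B) oindM ?unitmx_mul ?uB ?unitmx_inv //.
by rewrite det_mulmx sgzM det_inv /sgz invr_eq0 invr_lt0.
Qed.

End Side.

(** * Walls of a cubical decomposition *)

Section Decomposition.
Variables (R : realType) (m : nat) (I : finType).
Variables (a0 : 'rV[R]_m.+1) (v0 : 'M[R]_m.+1).
Variables (a : I -> 'rV[R]_m.+1) (v : I -> 'M[R]_m.+1).
Let dom := cube a0 v0.
Let cell i := cube (a i) (v i).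
Hypothesis rv0 : row_free v0.
Hypothesis rv : forall i, row_free (v i).
Hypothesis cover : dom = \bigcup_(i in [set: I]) cell i.
Hypothesis disjoint_int : forall i j, i != j -> (cell i)° `&` (cell j)° = set0.
Hypothesis meet_face : forall i j, i != j -> cell i `&` cell j = set0 \/
  (is_face (cell i) (cell i `&` cell j) /\ is_face (cell j) (cell i `&` cell j)).

Lemma cell_sub i : cell i `<=` dom.
Proof. by move=> x ix; rewrite cover; exists i. Qed.

Lemma coords_continuous (b : 'rV[R]_m.+1) (w : 'M[R]_m.+1) r :
  continuous (fun x => coords b w x 0 r).
Proof.
have -> : (fun x => coords b w x 0 r) =
    (fun x => \sum_j (x 0 j - b 0 j) * pinvmx w j r).
  by apply/funext => x; rewrite mxE; apply: eq_bigr => j _; rewrite !mxE.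
elim: (index_enum _) => [|j s IH] x.
  have -> : (fun y : 'rV[R]_m.+1 => \sum_(j <- [::]) (y 0 j - b 0 j) * pinvmx w j r) = cst 0.
    by apply/funext => y; rewrite big_nil.
  exact: cst_continuous.
have -> : (fun y : 'rV[R]_m.+1 => \sum_(j <- j :: s) (y 0 j - b 0 j) * pinvmx w j r) =
    (fun y => (y 0 j - b 0 j) * pinvmx w j r) \+
    (fun y => \sum_(j <- s) (y 0 j - b 0 j) * pinvmx w j r).
  by apply/funext => y; rewrite big_cons.
apply: cvgD (IH x); apply: cvgM; last exact: cvg_cst.
by apply: cvgB; [apply: coord_continuous | apply: cvg_cst].
Qed.

Lemma center_interior (b : 'rV[R]_m.+1) (w : 'M[R]_m.+1) : row_free w ->
  (cube b w)° (center b w).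
Proof.
move=> rw; rewrite /interior.
have h : \forall y \near center b w, forall r, 0 < coords b w y 0 r < 1.
  suff hr r : \forall y \near center b w, 0 < coords b w y 0 r < 1.
    exact: (@filter_forall _ _ (fun r y => is_true (0 < coords b w y 0 r < 1)) _ _ hr).
  have /(_ (center b w)) cr := @coords_continuous b w r.
  have c0 : 0 < coords b w (center b w) 0 r by rewrite coords_center //; lra.
  have c1 : coords b w (center b w) 0 r < 1 by rewrite coords_center //; lra.
  have h1 := cvgr_lt _ cr _ c1; have h0 := cvgr_gt _ cr _ c0.
  by near=> y; apply/andP; split; near: y; [exact: h0 | exact: h1].
apply: filterS h => y y01; apply/(cubeE _ _ rw); split.
  by move=> r; have := y01 r; lra.
exact: coords_decomp.
Unshelve. all: by end_near.
Qed.

(** Otherwise the center of [cell i] would be interior to both cells. *)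
Lemma cell_not_sub i j : i != j -> ~ cell i `<=` cell j.
Proof.
move=> ij sub; have := center_interior (a i) (rv i).
move=> ci; have : ((cell i)° `&` (cell j)°) (center (a i) (v i)).
  by split=> //; apply: interiorS ci.
by rewrite disjoint_int.
Qed.

Definition facet_ix : finType := (I * ('I_m.+1 * bool))%type.
Implicit Types t u w : facet_ix.

Definition wall t : set 'rV[R]_m.+1 := facet (a t.1) (v t.1) t.2.1 t.2.2.
Definition wall_center t := facet_center (a t.1) (v t.1) t.2.1 t.2.2.
Definition wall_frame t : 'M[R]_(m, m.+1) := row' t.2.1 (v t.1).
(** The condition by which the facets of the subdivided polytope are selected. *)
Definition outer t : bool :=
  `[< exists G, [/\ is_face dom G, G <> dom & wall t `<=` G] >].

Lemma wall_frameP t : is_frame (wall t) (wall_frame t).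
Proof. exact/cube_frame/row_free_row'. Qed.

Lemma wall_face t : is_face (cell t.1) (wall t).
Proof. exact: facet_face. Qed.

Lemma wall_center_in t : wall t (wall_center t).
Proof. exact: facet_center_in. Qed.

(** The intersection is a face of the first cell. It contains the center of the
wall, hence the wall, and it is not the whole cell, so it lies in a facet; that
facet contains the center of the wall and must be the wall itself. *)
Lemma cell_meet t j : t.1 != j -> cell j (wall_center t) ->
  cell t.1 `&` cell j = wall t.
Proof.
move=> tj jx; have tx : cell t.1 (wall_center t).
  by case: (wall_face t) => _ + _ _; apply; apply: wall_center_in.
have [e|[Ki Kj]] := meet_face tj.
  by have : (cell t.1 `&` cell j) (wall_center t) by []; rewrite e.
have SK : wall t `<=` cell t.1 `&` cell j.
  by apply: (@facet_of_facet_center _ _ _ _ _ _ _ _ (rv t.1) Ki).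
have nK : cell t.1 `&` cell j <> cell t.1.
  by move=> e; apply: (cell_not_sub tj); rewrite -e => x [].
have [p [b Kf]] := face_sub_facet (rv t.1) Ki nK.
have [e1 e2] := facet_center_inj (rv t.1) (Kf _ (SK _ (wall_center_in t))).
by apply/seteqP; split=> //; move: Kf; rewrite /wall e1 e2.
Qed.

(** Two cells with a common wall lie on opposite sides of it: if [y] and [y'] were
strictly on the same side, a point [z] of [cell t.1] slightly off the center of
the wall towards [y] would lie in both cells, hence in the wall by [cell_meet],
although its side does not vanish. *)
Lemma opposite_sides t u beta s y y' : t != u -> wall t = wall u ->
  is_frame (wall t) beta -> wall t s -> cell t.1 y -> cell u.1 y' ->
  side beta (s - y) * side beta (s - y') <= 0.
Proof.
case: t => i [p b]; case: u => j [q c] tu e Sb Ss /= iy jy'.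
have ij : i != j.
  apply: contra_neq tu => ij; move: e; rewrite ij /wall /= => /(facet_inj (rv j)).
  by move=> [-> ->].
set t : facet_ix := (i, (p, b)) in tu e Sb Ss *; set u : facet_ix := (j, (q, c)) in tu e *.
set x := wall_center t; rewrite leNgt; apply/negP => pos.
have Sx := wall_center_in t.
have xi : cell i x by case: (wall_face t) => _ + _ _; apply.
have xj : cell j x by case: (wall_face u) => _ + _ _; apply; rewrite -e.
have eS : wall t = wall u by [].
(* x is the center of the wall also from the point of view of the cell j: its
   coordinates other than the q-th are interior *)
have xq r (d : bool) : coords (a j) (v j) x 0 r = d%:R -> r = q.
  move=> er; have xF : facet (a j) (v j) r d x by apply/(facetE _ (rv j)).
  have SF : wall t `<=` facet (a j) (v j) r d.
    apply: face_symmetric_center (facet_face (a j) (rv j) r d) _ xF _.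
      by rewrite eS; case: (wall_face u).
    by move=> z; apply: cube_reflect.
  have := wall_center_in u; rewrite -eS => /SF Fu.
  by have [] := facet_center_inj (rv j) Fu.
have [x01 _] := (cubeE _ _ (rv j)).1 xj.
have [y01 _] := (cubeE _ _ (rv j)).1 jy'.
have Sj : wall t `<=` facet (a j) (v j) q c by rewrite eS.
have [k k0 E] := side_facet (rv j) Sb Sj.
have yq : 0 < (c%:R - coords (a j) (v j) y 0 q) * (c%:R - coords (a j) (v j) y' 0 q).
  move: pos; rewrite !E; try exact: Sj.
  by rewrite mulrACA pmulr_rgt0 // -expr2 exprn_even_gt0.
have xqc : coords (a j) (v j) x 0 q = c%:R.
  by case/(facetE _ (rv j)): (Sj _ Sx).
set X := coords (a j) (v j) x 0 in x01 xq xqc *.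
set Y := coords (a j) (v j) y 0 in yq *.
have xin r : r != q -> 0 < X r < 1.
  move=> rq; have := x01 r; rewrite !le_eqVlt => /andP[/orP[/eqP h|->] /orP[/eqP h'|h']] //.
  - by rewrite (xq r false) ?eqxx in rq.
  - by rewrite (xq r false) ?eqxx in rq.
  by rewrite (xq r true) ?eqxx in rq.
(* the bound satisfied with equality, t q = c, is left out here: the sign of yq
   takes care of it *)
have [|e0 e0p small] := @small_perturbation R ('I_m.+1 * bool)%type
    (fun h => if (h.1 == q) && (h.2 == c) then 1
              else if h.2 then 1 - X h.1 else X h.1)
    (fun h => if (h.1 == q) && (h.2 == c) then 0
              else if h.2 then X h.1 - Y h.1 else Y h.1 - X h.1).
  move=> [r d] /=; case: eqP => [->|/eqP/xin] /=; last by case: d; lra.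
  by rewrite xqc; case: (c); case: d => /=; lra.
pose e1 := Num.min e0 2^-1.
have e1p : 0 < e1 <= e0 by rewrite /e1 lt_min e0p invr_gt0 ltr0n ge_min lexx.
have e11 : 0 < e1 < 1.
  by case/andP: e1p => -> _ /=; rewrite /e1 gt_min; apply/orP; right; lra.
pose z := e1 *: y + (1 - e1) *: x.
have iz : cell i z by apply: cube_conv.
have jz : cell j z.
  apply/(cubeE _ _ (rv j)); split; last exact: coords_decomp.
  move=> r; rewrite coords_conv -/(X r) -/(Y r).
  have := small e1 e1p (r, false); have := small e1 e1p (r, true); rewrite /=.
  case: (r =P q) => [->|_] /=; last by lra.
  have := y01 q; rewrite xqc; move: yq; rewrite -/(Y q).
  by case: (c) => /=; nra.
have : (cell i `&` cell j) z by [].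
rewrite (cell_meet (t := t)) // => Sz.
have Si : wall t `<=` facet (a i) (v i) p b by [].
have [k' k'0 E'] := side_facet (rv i) Sb Si.
have : side beta (x - z) = 0.
  have [_ zp] := (facetE _ (rv i) _ _ _).1 (Si _ Sz).
  by rewrite E' // zp subrr mulr0.
have -> : x - z = e1 *: (x - y) by apply/rowP => r; rewrite !mxE; ring.
rewrite sideZ => /eqP; rewrite mulf_eq0 => /orP[/eqP e10|/eqP sy].
  by move: e11; rewrite e10 ltxx.
by move: pos; rewrite (_ : side beta (s - y) = 0) ?mul0r ?ltxx // -sy !E'.
Qed.

Variables (f : 'rV[R]_m.+1 -> nat) (B : 'M[R]_m.+1).
Hypothesis uB : B \in unitmx.

Let term t : int := contrib f B (v t.1) (a t.1) t.2.1 t.2.2.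

Lemma wall_side t u beta s : wall t = wall u -> is_frame (wall t) beta ->
  wall t s -> side beta (s - center (a u.1) (v u.1)) != 0.
Proof.
move=> e Sb Ss.
have Su : wall t `<=` facet (a u.1) (v u.1) u.2.1 u.2.2 by rewrite e.
exact: side_center (rv u.1) Sb Su Ss.
Qed.

Lemma cells_side_neg t u beta s : t != u -> wall t = wall u ->
  is_frame (wall t) beta -> wall t s ->
  side beta (s - center (a t.1) (v t.1)) *
  side beta (s - center (a u.1) (v u.1)) < 0.
Proof.
move=> tu e Sb Ss; rewrite lt_neqAle; apply/andP; split.
  by rewrite mulf_neq0 ?(wall_side _ Sb).
by apply: opposite_sides tu e Sb Ss _ _; apply: cube_center.
Qed.

Lemma term_wall t u beta s : wall t = wall u -> is_frame (wall t) beta ->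
  wall t s -> term u = sgz (\det B) *
    sgz (side beta (s - center (a u.1) (v u.1))) * oind f (wall t) beta.
Proof.
move=> e Sb Ss; rewrite e; apply: contribE; rewrite // -?/(wall u) -?e //.
  exact: cube_center.
exact: wall_side Sb Ss.
Qed.

Lemma term_opp t u : t != u -> wall t = wall u -> term u = - term t.
Proof.
move=> tu e; have Sb := wall_frameP t; have Ss := wall_center_in t.
rewrite (term_wall e Sb Ss) (term_wall erefl Sb Ss) -mulNr -mulrN.
congr (_ * _ * _); have := cells_side_neg tu e Sb Ss.
move: (side _ _) (side _ _) => x y; have [y0|y0|->] := ltgtP y 0.
- by rewrite nmulr_rlt0 // => x0; rewrite gtr0_sgz // ltr0_sgz.
- by rewrite pmulr_rlt0 // => x0; rewrite ltr0_sgz // gtr0_sgz.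
by rewrite mul0r ltxx.
Qed.

(** Three cells cannot lie pairwise on opposite sides of a hyperplane. *)
Lemma at_most_two t u w : t != u -> t != w -> wall t = wall u ->
  wall t = wall w -> u = w.
Proof.
move=> tu tw eu ew; apply: contrapT => /eqP uw.
have Sb := wall_frameP t; have Ss := wall_center_in t.
have ntu := cells_side_neg tu eu Sb Ss; have ntw := cells_side_neg tw ew Sb Ss.
have euw : wall u = wall w by rewrite -eu.
have Sbu : is_frame (wall u) (wall_frame t) by rewrite -eu.
have Ssu : wall u (wall_center t) by rewrite -eu.
have nuw := cells_side_neg uw euw Sbu Ssu.
move: ntw; rewrite -(nmulr_rgt0 _ ntu) mulrACA ltNge => /negP; apply.
by rewrite -expr2 mulr_ge0_le0 ?sqr_ge0 // ltW.
Qed.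

Lemma wall_sub t : wall t `<=` dom.
Proof. by apply: subset_trans (@cell_sub t.1); case: (wall_face t). Qed.

Lemma outer_facet t : outer t -> exists p b, wall t `<=` facet a0 v0 p b.
Proof.
case/asboolP=> G [dG nG tG]; have [p [b GF]] := face_sub_facet rv0 dG nG.
by exists p, b; apply: subset_trans GF.
Qed.

Lemma facet_proper p b : facet a0 v0 p b <> dom.
Proof.
move=> e; have : facet a0 v0 p b (facet_center a0 v0 p (~~ b)).
  by rewrite e; apply: facet_sub (facet_center_in a0 v0 p (~~ b)).
by move=> /(facet_center_inj rv0)[_]; case: (b).
Qed.

(** The big cube, and with it all the cells, lies on one side of the wall. *)
Lemma outer_unique t u : outer t -> wall t = wall u -> t = u.
Proof.
move=> /outer_facet[p [b tF]] e; apply: contrapT => /eqP tu.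
have Sb := wall_frameP t; have Ss := wall_center_in t.
have := cells_side_neg tu e Sb Ss; rewrite ltNge => /negP; apply.
by apply: (side_same_sign rv0 Sb tF Ss Ss);
  apply: cell_sub; apply: cube_center.
Qed.

(** If a coordinate of the center were 0 or 1, the center, and then the whole
wall, would lie in a facet of the big cube. *)
Lemma inner_coords t r : ~~ outer t ->
  0 < coords a0 v0 (wall_center t) 0 r < 1.
Proof.
move=> nt; set x := wall_center t.
have dx : dom x by apply/wall_sub/wall_center_in.
have nb (d : bool) : coords a0 v0 x 0 r != d%:R.
  apply: contra nt => /eqP er; apply/asboolP; exists (facet a0 v0 r d).
  split; [exact: facet_face | exact: facet_proper |].
  have xF : facet a0 v0 r d x by apply/(facetE _ rv0).
  apply: (face_symmetric_center (facet_face a0 rv0 r d) (@wall_sub t) xF).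
  by move=> z; apply: cube_reflect.
have [/(_ r) /andP[x0 x1] _] := (cubeE _ _ rv0).1 dx.
by rewrite !lt_neqAle x0 x1 (nb true) eq_sym (nb false).
Qed.

Lemma coords_ray (b : 'rV[R]_m.+1) (w : 'M[R]_m.+1) x y e r :
  coords b w (x + e *: (x - y)) 0 r =
  coords b w x 0 r + e * (coords b w x 0 r - coords b w y 0 r).
Proof.
rewrite /coords (_ : x + _ - b = (x - b) + e *: ((x - b) - (y - b))); last first.
  by apply/rowP => j; rewrite !mxE; ring.
move: (x - b) (y - b) => X Y; rewrite mulmxDl -scalemxAl mulmxBl.
by move: (X *m _) (Y *m _) => {}X {}Y; rewrite !mxE.
Qed.

(** Move from the center [x] of the wall slightly away from the cell. One stays in
the big cube since [x] is interior to it, hence arrives in some cell [j]. The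
finitely many cells that do not contain [x] stay out of reach if the step is small
enough, so [x] belongs to [cell j] and [cell_meet] applies. *)
Lemma inner_partner t : ~~ outer t -> exists2 u, u != t & wall u = wall t.
Proof.
move=> nt; set x := wall_center t; set i := t.1.
pose y := center (a i) (v i).
have Sb := wall_frameP t; have Ss := wall_center_in t; rewrite -/x in Ss.
have iy : cell i y by apply: cube_center.
pose X := coords a0 v0 x 0; pose Y := coords a0 v0 y 0.
have [|e1 e1p small1] := @small_perturbation R ('I_m.+1 * bool)%type
    (fun h => if h.2 then 1 - X h.1 else X h.1)
    (fun h => if h.2 then Y h.1 - X h.1 else X h.1 - Y h.1).
  by move=> [r []] /=; have := inner_coords r nt; rewrite -/x -/(X r); lra.
have ray j e r : coords (a j) (v j) (x + e *: (x - y)) 0 r =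
    coords (a j) (v j) x 0 r +
    e * (coords (a j) (v j) x 0 r - coords (a j) (v j) y 0 r).
  exact: coords_ray.
(* for a cell avoiding x, dir is an affine function positive at x that becomes
   nonpositive before the ray enters the cell *)
have leave j : exists dir : R * R, 0 < dir.1 /\
    (~ cell j x -> forall e, 0 < dir.1 + e * dir.2 ->
                             ~ cell j (x + e *: (x - y))).
  have [jx|njx] := pselect (cell j x); first by exists (1, 0); split=> //=.
  have [r nr] : exists r, ~~ (0 <= coords (a j) (v j) x 0 r <= 1).
    apply: contrapT => h; apply: njx; apply/(cubeE _ _ (rv j)).
    split; last exact: coords_decomp.
    by move=> r; apply: contrapT => /negP nr; apply: h; exists r.
  pose Xj := coords (a j) (v j) x 0; pose Yj := coords (a j) (v j) y 0.
  have [lt0|ge0] := ltP (Xj r) 0.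
    exists (- Xj r, Yj r - Xj r); split=> /= [|_ e he]; first by rewrite oppr_gt0.
    move=> /(cubeE _ _ (rv j))[/(_ r) + _]; rewrite ray -/(Xj r) -/(Yj r).
    by move: he; lra.
  have gt1 : 1 < Xj r by move: nr; rewrite ge0 /= -ltNge.
  exists (Xj r - 1, Xj r - Yj r); split=> /= [|_ e he]; first by rewrite subr_gt0.
  move=> /(cubeE _ _ (rv j))[/(_ r) + _]; rewrite ray -/(Xj r) -/(Yj r).
  by move: he; lra.
have [d hd] := choice leave.
have [|e2 e2p small2] := @small_perturbation R I (fun j => (d j).1) (fun j => (d j).2).
  by move=> j; case: (hd j).
pose e := Num.min e1 e2.
have ep : 0 < e by rewrite lt_min e1p.
have dz : dom (x + e *: (x - y)).
  apply/(cubeE _ _ rv0); split; last exact: coords_decomp.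
  move=> r; rewrite coords_ray -/(X r) -/(Y r).
  have ee : 0 < e <= e1 by rewrite ep ge_min lexx.
  by have := small1 e ee (r, false); have := small1 e ee (r, true); rewrite /=; lra.
have [j _ jz] : (\bigcup_(j in [set: I]) cell j) (x + e *: (x - y)) by rewrite -cover.
have jx : cell j x.
  apply: contrapT => njx; have [_ /(_ njx e)] := hd j; apply=> //.
  by apply: small2; rewrite ep ge_min lexx orbT.
have ij : i != j.
  apply/negP => /eqP ij; rewrite -ij in jz.
  have Si : wall t `<=` facet (a i) (v i) t.2.1 t.2.2 by [].
  have := side_same_sign (rv i) Sb Si Ss Ss iy jz.
  have -> : x - (x + e *: (x - y)) = (- e) *: (x - y).
    by apply/rowP => r; rewrite !mxE; ring.
  rewrite sideZ mulrCA mulNr oppr_ge0 leNgt pmulr_rgt0 // -expr2.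
  by rewrite exprn_even_gt0 //= (@wall_side t t).
have meet := cell_meet ij jx.
have : is_face (cell j) (wall t).
  by rewrite -meet; case: (meet_face ij) => [e0|[]//]; move: Ss; rewrite -meet e0.
move=> jt; have : faces_of_dim (std_polytope (cell j)) m (wall t).
  by split=> //; exists (wall_frame t).
move=> /(cube_faces_of_dim _ _ (rv j))[q [c ec]].
exists (j, (q, c)); last by rewrite ec.
by apply: contra_neq ij => tE; rewrite /i -tE.
Qed.

Lemma sum_inner : \sum_(t | ~~ outer t) term t = 0.
Proof.
pose tau t := odflt t [pick u | (u != t) && `[< wall u = wall t >]].
have tauP t : ~~ outer t -> tau t != t /\ wall (tau t) = wall t.
  move=> nt; rewrite /tau; case: pickP => [u /andP[ut /asboolP] //|none].
  have [u ut e] := inner_partner nt.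
  by have := none u; rewrite ut asboolT.
have inner_tau t : ~~ outer t -> ~~ outer (tau t).
  by move=> nt; have [_ e] := tauP t nt; rewrite /outer e.
apply: (@sum_sign_reversing _ _ _ tau) => // t nt; have [tt e] := tauP t nt.
  have [tt' e'] := tauP _ (inner_tau _ nt).
  by apply: (@at_most_two (tau t)) => //; rewrite eq_sym.
by apply: term_opp; [rewrite eq_sym|].
Qed.

(** Summing the facet expansions over all the cells, the inner walls cancel. *)
Lemma sum_cells :
  \sum_i \sum_(s : 'I_m.+1 * bool) contrib f B (v i) (a i) s.1 s.2 =
  \sum_(t | outer t) term t.
Proof.
by rewrite pair_bigA (bigID outer) /= sum_inner addr0.
Qed.

(** * The index of the subdivided cube *)

Let Ct := subdivided_polytope dom cell.

Lemma dom_not_dim k S : has_dim S k -> (k < m.+1)%N -> S <> dom.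
Proof.
move=> [b Sb] km e; rewrite e in Sb.
by have := frame_dim Sb (cube_frame a0 rv0) => kk; rewrite kk ltnn in km.
Qed.

Lemma subdivided_facets S :
  faces_of_dim Ct m S <-> exists2 t, outer t & S = wall t.
Proof.
split=> [[/= [e|[[i iS] oS]] dS]|[t /asboolP[G oG] ->]].
- by case: (dom_not_dim dS (ltnSn _)).
- have : faces_of_dim (std_polytope (cell i)) m S by [].
  move=> /(cube_faces_of_dim _ _ (rv i))[p [b e]].
  exists (i, (p, b)); last by [].
  by apply/asboolP; move: oS; rewrite e.
split; last exact: facet_has_dim.
by right; split; [exists t.1; apply: wall_face | exists G].
Qed.

Lemma sum_subdivided_facets (G : set 'rV[R]_m.+1 -> int) :
  \sum_(S \in faces_of_dim Ct m) G S = \sum_(t | outer t) G (wall t).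
Proof.
apply: fsbig_finType => [t ot|t u ot _ e|S /subdivided_facets[t ot ->]].
- by apply/subdivided_facets; exists t.
- exact: outer_unique.
by exists t.
Qed.

(** The cell lies in the big cube, hence on the same side of the wall as any of its
points [y]: the wall has the same induced orientation from both. *)
Lemma term_outer t beta s y : outer t -> is_frame (wall t) beta -> wall t s ->
  dom y -> side beta (s - y) != 0 ->
  term t = sgz (\det B) * sgz (side beta (s - y)) * oind f (wall t) beta.
Proof.
move=> ot Sb Ss dy s0; rewrite (term_wall erefl Sb Ss).
have [p [b tF]] := outer_facet ot.
congr (_ * _ * _); apply: (side_sgz rv0 Sb tF Ss Ss _ dy _ s0).
  by apply: cell_sub; apply: cube_center.
exact: wall_side Sb Ss.
Qed.

(** Below an outer wall the subdivided structure is that of the wall: a face of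
another cell [j] lying in [S] also lies in the common face of the two cells, hence
is a face of [cell i]. *)
Lemma face_of_subdivided i S G : is_face (cell i) S -> is_face dom G ->
  G <> dom -> S `<=` G -> face_polytope Ct S = std_polytope S.
Proof.
move=> iS dG nG SG; congr Polytope; apply/seteqP; split=> F /=; last first.
  move=> SF; have FS : F `<=` S by case: SF.
  split=> //; right; split; first by exists i; apply/(face_of_face iS FS).
  by exists G; split=> //; apply: subset_trans SG.
case=> -[->|[[j jF] _]] FS.
  by case: nG; apply/seteqP; split; [case: dG | apply: subset_trans SG].
apply/(face_of_face iS FS).
have [<-|ij] := eqVneq j i; first by [].
have Fi : F `<=` cell i by apply: subset_trans FS _; case: iS.
have FK : F `<=` cell j `&` cell i.
  by move=> x Fx; split; [case: jF => _ + _ _; apply | apply: Fi].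
have [e|[Kj Ki]] := meet_face ij.
  by case: jF => -[x Fx] *; have := FK _ Fx; rewrite e.
by apply/(face_of_face Ki FK)/(face_of_face Kj FK).
Qed.

Lemma term_induced t b : outer t -> induces dom B (wall t) b ->
  term t = oind f (wall t) b.
Proof.
move=> ot [Sb [s [y [M [Ss dy M0 eM]]]]].
have dB : \det B != 0 by rewrite -unitfE -unitmxE.
have sE : side b (s - y) = \det M * \det B.
  by rewrite /side eM -det_mulmx.
rewrite (term_outer ot Sb Ss dy) sE; last by rewrite mulf_neq0 // lt0r_neq0.
by rewrite sgzM (gtr0_sgz M0) mul1r sgz_sqr // mul1r.
Qed.

Lemma wall_inducible t : (0 < m)%N ->
  induces dom B (wall t) (induced_frame dom B (wall t)).
Proof.
move=> m0; have Ss := wall_center_in t; have Sb := wall_frameP t.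
pose y := center (a t.1) (v t.1).
have dy : dom y by apply: cell_sub; apply: cube_center.
apply: (@induced_frameP _ _ _ _ _ _ (wall_frame t) (wall_center t) y
  ((col_mx (wall_center t - y) (wall_frame t) : 'M_(1 + m)) *m invmx B)) => //.
  by rewrite mulmxKV.
rewrite det_mulmx det_inv mulf_neq0 ?invr_eq0 //.
  exact: (@wall_side t t).
by rewrite -unitfE -unitmxE.
Qed.

Lemma ind_subdivided_rec : (0 < m)%N -> ind f Ct B != 0 ->
  ind f Ct B = \sum_(t | outer t) term t.
Proof.
move=> m0; rewrite ind_facets //; case: asboolP => [_ _|]; last by rewrite eqxx.
rewrite sum_subdivided_facets; apply: eq_bigr => t ot.
have [G [dG nG tG]] : exists G, [/\ is_face dom G, G <> dom & wall t `<=` G].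
  exact/asboolP.
rewrite (face_of_subdivided (wall_face t) dG nG tG) -oindS //.
by apply/esym/term_induced => //; apply: wall_inducible.
Qed.

(** In dimension 1 the index is determined by the vertices, and a subdivision does
not change the endpoints of a segment. The next lemmas, up to
[ind_vertices_dim1], keep [m] abstract under the hypothesis [m = 0], which avoids
transporting the section hypotheses along this equality. *)
Lemma facet_point (b : 'rV[R]_m.+1) (w : 'M[R]_m.+1) p c : m = 0%N ->
  exists x, facet b w p c = [set x].
Proof.
move=> m0; have h k (w' : 'M[R]_(k, m.+1)) b' : k = 0%N ->
    exists x, cube b' w' = [set x].
  by move=> k0; rewrite k0 in w' *; exists b'; apply: cube0.
exact: h.
Qed.

Lemma vertices_subdivided : m = 0%N -> vertices Ct = vertices (std_polytope dom).
Proof.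
move=> m0; have nd x : [set x] <> dom by apply: (dom_not_dim (set1_dim0 x)).
apply/seteqP; split=> x; rewrite /vertices /=.
  case=> [/nd//|[_ [G [dG nG xG]]]].
  have [p [b GF]] := face_sub_facet rv0 dG nG.
  have [y Fy] := facet_point a0 v0 p b m0.
  have -> : [set x] = facet a0 v0 p b.
    by have := GF _ (xG _ erefl); rewrite Fy => /= ->.
  exact: facet_face.
move=> dx; right; split; last by exists [set x]; split.
have [_ /(_ x erefl) xd _ _] := dx.
have [i _ ix] : (\bigcup_(j in [set: I]) cell j) x by rewrite -cover.
exists i; move/is_faceP: dx => [S0 _ cS eS]; apply/is_faceP; split=> //.
  by move=> _ ->.
by move=> y z e iy iz; apply: eS; [exact: cell_sub iy | exact: cell_sub iz].
Qed.

Lemma subdivided_facets_dim1 : m = 0%N ->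
  faces_of_dim Ct m = faces_of_dim (std_polytope dom) m.
Proof.
move=> m0; have vE := vertices_subdivided m0.
apply/seteqP; split=> S [FS dS]; split=> //.
  have [|t _ eS] := (subdivided_facets S).1; first by split.
  have [x ex] := facet_point (a t.1) (v t.1) t.2.1 t.2.2 m0.
  rewrite /wall ex in eS; rewrite eS; have : vertices Ct x by rewrite /vertices /= -eS.
  by rewrite vE.
have [|p [b eS]] := (cube_faces_of_dim a0 S rv0).1; first by split.
have [x ex] := facet_point a0 v0 p b m0.
rewrite ex in eS; have : vertices (std_polytope dom) x by rewrite /vertices /= -eS.
by rewrite -vE eS.
Qed.

(** Both sums run over the two endpoints of the segment. The frame and the point
chosen in [G] make the summand a function of the wall alone, so that the sum can
be reindexed from the cells to the big cube. *)
Lemma sum_outer_dim1 : m = 0%N -> \sum_(t | outer t) term t =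
  \sum_(s : 'I_m.+1 * bool) contrib f B v0 a0 s.1 s.2.
Proof.
move=> m0; pose fr (S : set 'rV[R]_m.+1) : 'M[R]_(m, m.+1) := xget 0 (@is_frame R _ m S).
pose G S := sgz (\det B) * sgz (side (fr S) (xget 0 S - center a0 v0)) * oind f S (fr S).
have frP S : has_dim S m -> is_frame S (fr S) /\ S (xget 0 S).
  move=> [b Sb]; split; first by apply: xgetPex; exists b.
  by case: Sb => S0 _ _ _; apply: xgetPex.
have dc : dom (center a0 v0) by apply: cube_center.
transitivity (\sum_(t | outer t) G (wall t)).
  apply: eq_bigr => t ot; have [|Sb Ss] := frP (wall t); first exact: facet_has_dim.
  apply: term_outer => //; have [p [b tF]] := outer_facet ot.
  exact: side_center rv0 Sb tF Ss.
rewrite -sum_subdivided_facets subdivided_facets_dim1 // fsbig_facets //.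
apply: eq_bigr => -[p b] _ /=.
have [|Sb Ss] := frP (facet a0 v0 p b); first exact: facet_has_dim.
apply/esym/contribE => //.
have sF : facet a0 v0 p b `<=` facet a0 v0 p b by [].
exact: side_center rv0 Sb sF Ss.
Qed.

Hypothesis lab : forall x, (1 <= f x <= m.+2)%N.

Lemma ind_vertices_dim1 (P Q : polytope R m.+1) : m = 0%N ->
  vertices P = vertices Q -> ind f P B = ind f Q B.
Proof.
move=> m0 e; have h k (b : 'M[R]_(k.+1, m.+1)) : k = 0%N -> ind f P b = ind f Q b.
  by move=> k0; rewrite k0 in b *; apply: ind_vertices.
exact: h.
Qed.

Lemma ind_subdivided : ind f Ct B != 0 -> ind f Ct B = \sum_(t | outer t) term t.
Proof.
have [m0 _|m0] := posnP m; last exact: ind_subdivided_rec.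
rewrite (ind_vertices_dim1 m0 (vertices_subdivided m0)) sum_outer_dim1 //.
exact: ind_contrib.
Qed.

Lemma exists_cell : ind f Ct B != 0 ->
  exists i, ind f (std_polytope (cell i)) B != 0.
Proof.
move=> h; apply: contrapT => none; move: (h).
rewrite ind_subdivided // -sum_cells big1 ?eqxx // => i _.
rewrite -ind_contrib //; apply: contrapT => /eqP hi; apply: none.
by exists i.
Qed.

End Decomposition.

(** * Complete labelings and the theorem *)

Section VectorLabelings.
Variables (R : realType) (n : nat).

(** A nonzero index only says that every integer label occurs; the change of
labels turns this into completeness, since the orthants of the corresponding
vector labels are contained in pairwise different cones of the partition. *)
Lemma completely_labeled_of_ind (phi : 'rV[R]_n -> vlabel n)
    (N : 'I_n.+1 -> set 'rV[R]_n) (psi : vlabel n -> 'I_n.+1)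
    (P : polytope R n) (B : 'M[R]_n) :
  is_change_of_labels N psi -> vind psi phi P B != 0 -> completely_labeled phi P.
Proof.
move=> [[_ _ _ capN] ON] /ind_full ful.
have hit (j : 'I_n.+1) : exists x, vertices P x /\ psi (phi x) = j.
  have : [set k | (1 <= k <= n.+1)%N] j.+1 by rewrite /= ltn_ord.
  by rewrite -ful => -[x Px [e]]; exists x; split=> //; apply/val_inj.
have [g gP] := choice hit.
exists (fun j => phi (g j)); split=> [j|]; first by exists (g j); case: (gP j).
apply/seteqP; split=> [z Oz|_ -> j _ k]; last by rewrite /half_space /= mxE mulr0.
rewrite -capN => j _; have [_ <-] := gP j; apply: ON; exact: Oz.
Qed.

End VectorLabelings.

Unset Implicit Arguments.

(* B is a basis of R^n giving the common orientation of C and of the cubes c i. *)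
Theorem theorem3p4 (R : realType) (n : nat) (C : set 'rV[R]_n)
    (I : finType) (c : I -> set 'rV[R]_n)
    (phi : 'rV[R]_n -> vlabel n)
    (N : 'I_n.+1 -> set 'rV[R]_n) (psi : vlabel n -> 'I_n.+1)
    (B : 'M[R]_n) :
  is_cube n C ->
  is_cubical_decomposition C c ->
  nondegenerate_labeling phi (subdivided_polytope C c) ->
  is_change_of_labels N psi ->
  B \in unitmx ->
  vind psi phi (subdivided_polytope C c) B <> 0 ->
  exists i : I,
    vind psi phi (std_polytope (c i)) B <> 0 /\
    completely_labeled phi (std_polytope (c i)).
Proof.
move=> [a0 [v0 [rv0 eC]]] [cubes cover disj meet] _ chg uB /eqP h.
suff [i ci0] : exists i, vind psi phi (std_polytope (c i)) B != 0.
  by exists i; split; [apply/eqP | apply: completely_labeled_of_ind chg ci0].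
have /choice[g gP] : forall i, exists av : 'rV[R]_n * 'M[R]_n,
    row_free av.2 /\ c i = cube av.1 av.2.
  by move=> i; have [a [v [rv ci]]] := cubes i; exists (a, v).
have {}eC : C = cube a0 v0 by [].
have ec : c = fun i => cube (g i).1 (g i).2.
  by apply/funext => i; case: (gP i).
have rv i : row_free (g i).2 by case: (gP i).
case: n => [|m] in C c phi N psi B a0 v0 rv0 eC cubes cover disj meet chg uB h
  g gP ec rv *.
  (* in dimension 0 every cube is the origin and carries the only label, 1 *)
  have : C (center a0 v0) by rewrite eC; apply: cube_center.
  rewrite cover => -[i _ _]; exists i; rewrite ec cube0.
  have : oind (fun x => (psi (phi x)).+1) [set (g i).1] B != 0.
    by rewrite oind_set1 ord1.
  by rewrite /oind mulf_eq0 negb_or => /andP[].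
rewrite eC ec in cover disj meet h *.
have lab x : (1 <= (psi (phi x)).+1 <= m.+2)%N by rewrite /= ltn_ord.
exact: (@exists_cell R m I a0 v0 (fun i => (g i).1) (fun i => (g i).2)
  rv0 rv cover disj meet _ B uB lab h).
Qed.
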